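(* Let $\eta\in\mathbb{R}\setminus\{0\}$, let $\Lambda\subset\mathbb{R}^{2n}$ be a lattice and $\phi\in L^2(\mathbb{R}^n)$ be such that $\mathcal G_\eta(\phi,\Lambda)$ is a Gabor frame for $L^2(\mathbb{R}^n)$. Let $a\in L^2(\mathbb{R}^{2n})$ be real-valued and $\widehat A_\eta=\operatorname{Op}^{\mathrm W}_\eta(a)$. For $\lambda,\mu\in\Lambda$ put $$a_{\lambda,\mu}=\int_{\mathbb{R}^{2n}}e^{-\frac{i}{\eta}\sigma(z,\lambda-\mu)}a(z)\,W_\eta\phi\big(z-\tfrac12(\lambda+\mu)\big)\,dz,\qquad M_{\lambda,\mu}=e^{-\frac{i}{2\eta}\sigma(\lambda,\mu)}a_{\lambda,\mu}.$$ (i) $\widehat A_\eta\ge0$ if and only if for every integer $N\ge0$ the finite matrix $M_{(N)}=(M_{\lambda,\mu})_{\lambda,\mu\in\Lambda,\ |\lambda|,|\mu|\le N}$ is positive semidefinite. (ii) The same equivalence holds if $M_{(N)}$ is replaced by the matrix $M'_{(N)}=(M'_{\lambda,\mu})_{\lambda,\mu\in\Lambda,\ |\lambda|,|\mu|\le N}$ with $M'_{\lambda,\mu}=W_\eta\big(a,(W_\eta\phi)^\vee\big)\big(\tfrac14(\lambda+\mu),\tfrac12J(\mu-\lambda)\big)$, where $(W_\eta\phi)^\vee(z)=W_\eta\phi(-z)$ and $W_\eta(a,(W_\eta\phi)^\vee)$ is the $\eta$-cross-Wigner transform of these two functions on $\mathbb{R}^{2n}$ (a function on $\mathbb{R}^{2n}\times\mathbb{R}^{2n}$);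 indeed $M'_{\lambda,\mu}$ is a fixed positive constant (independent of $\lambda,\mu$) times $M_{\lambda,\mu}$.
   Context: Points of $\mathbb{R}^{2n}$ are written $z=(x,p)$. $J=\begin{pmatrix}0&I_n\\-I_n&0\end{pmatrix}$, $\sigma(z,z')=Jz\cdot z'=p\cdot x'-p'\cdot x$. $(\psi|\phi)_{L^2}=\int\psi\overline\phi$. For $\eta\ne0$ and functions on $\mathbb{R}^d$ (here $d=n$ or $d=2n$), the $\eta$-cross-Wigner transform is $W_\eta(f,g)(X,P)=(2\pi\eta)^{-d}\int_{\mathbb{R}^d}e^{-\frac{i}{\eta}P\cdot Y}f(X+\tfrac12Y)\overline{g(X-\tfrac12Y)}\,dY$, $(X,P)\in\mathbb{R}^d\times\mathbb{R}^d$, and $W_\eta f=W_\eta(f,f)$. The Weyl operator $\operatorname{Op}^{\mathrm W}_\eta(a)$ is defined by $\langle\operatorname{Op}^{\mathrm W}_\eta(a)\psi,\overline\phi\rangle=\langle a,W_\eta(\psi,\phi)\rangle$ for Schwartz $\psi,\phi$; for $a\in L^2(\mathbb{R}^{2n})$ it is a bounded (Hilbert–Schmidt) operator on $L^2(\mathbb{R}^n)$ and $(\operatorname{Op}^{\mathrm W}_\eta(a)\psi|\psi)_{L^2}=\int a\,W_\eta\psi$. $\widehat A\ge0$ means $(\widehat A\psi|\psi)_{L^2}\ge0$ for all $\psi\in L^2(\mathbb{R}^n)$. The Heisenberg $\eta$-displacement operator is $T_\eta(z_0)\psi(x)=e^{\frac{i}{\eta}(p_0\cdot x-\frac12p_0\cdot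 x_0)}\psi(x-x_0)$ for $z_0=(x_0,p_0)$. $\mathcal G_\eta(\phi,\Lambda)=\{T_\eta(\lambda)\phi:\lambda\in\Lambda\}$ is a Gabor frame if there are $0<A\le B$ with $A\|f\|_2^2\le\sum_{\lambda\in\Lambda}|(f|T_\eta(\lambda)\phi)_{L^2}|^2\le B\|f\|_2^2$ for all $f\in L^2(\mathbb{R}^n)$. A matrix $(M_{\lambda,\mu})$ is positive semidefinite if $\sum_{\lambda,\mu}\zeta_\lambda\overline{\zeta_\mu}M_{\lambda,\mu}\ge0$ for all complex vectors $\zeta$. *)

(* Defs.v *)
From HB Require Import structures.
From mathcomp Require Import all_boot all_order all_algebra.
From mathcomp Require Import all_classical all_reals all_analysis.
From mathcomp Require Import complex.

Set Implicit Arguments.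
Unset Strict Implicit.
Unset Printing Implicit Defensive.
Import Order.TTheory GRing.Theory Num.Theory.
Local Open Scope classical_set_scope.
Local Open Scope ring_scope.

Section Defs.
Variable R : realType.
Local Notation C := R[i].

Definition RtoC (x : R) : C := Complex x 0.

Definition expi (t : R) : C := Complex (cos t) (sin t).

Definition cabs2 (z : C) : R := complex.Re z ^+ 2 + complex.Im z ^+ 2.

Definition cint (g : R -> C) : C :=
  Complex (Rintegral lebesgue_measure setT (fun x => complex.Re (g x)))
          (Rintegral lebesgue_measure setT (fun x => complex.Im (g x))).

(** Iterated Lebesgue integrals over R^d (coordinates given as a list).
   By Fubini/Tonelli these coincide with the Lebesgue integral over R^d for
   integrable (resp. nonnegative measurable) integrands. *)
Fixpoint iintC (d : nat) (f : seq R -> C) : C :=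
  match d with
  | 0 => f [::]
  | d'.+1 => cint (fun x => iintC d' (fun s => f (x :: s)))
  end.

Fixpoint iintE (d : nat) (f : seq R -> \bar R) : \bar R :=
  match d with
  | 0 => f [::]
  | d'.+1 => (\int[lebesgue_measure]_x iintE d' (fun s => f (x :: s)))%E
  end.

Definition vec_of_seq (d : nat) (s : seq R) : 'rV[R]_d := \row_(i < d) nth 0 s i.

Definition rintC (d : nat) (f : 'rV[R]_d -> C) : C :=
  iintC d (fun s => f (vec_of_seq d s)).

(** Borel measurability of f : R^d -> C (R^d carries the product sigma-algebra
    of d.-tuple R, i.e. the Borel sigma-algebra). *)
Definition rmeas (d : nat) (f : 'rV[R]_d -> C) : Prop :=
  measurable_fun setT (fun t : d.-tuple R => complex.Re (f (\row_(i < d) tnth t i))) /\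
  measurable_fun setT (fun t : d.-tuple R => complex.Im (f (\row_(i < d) tnth t i))).

Definition norm2 (d : nat) (f : 'rV[R]_d -> C) : \bar R :=
  iintE d (fun s => (cabs2 (f (vec_of_seq d s)))%:E).

Definition L2 (d : nat) (f : 'rV[R]_d -> C) : Prop :=
  rmeas f /\ (norm2 f < +oo)%E.

Definition ip (d : nat) (f g : 'rV[R]_d -> C) : C :=
  rintC (fun x => f x * conjc (g x)).

Definition dotv (d : nat) (u v : 'rV[R]_d) : R := \sum_(i < d) u ord0 i * v ord0 i.

(** phase space R^{2n} = 'rV_(n+n), z = (x,p) with x = lsubmx z, p = rsubmx z *)
Definition Jmap (n : nat) (z : 'rV[R]_(n + n)) : 'rV[R]_(n + n) :=
  row_mx (rsubmx z) (- lsubmx z).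

Definition sympl (n : nat) (z z' : 'rV[R]_(n + n)) : R := dotv (Jmap z) z'.

Definition wigner (eta : R) (d : nat) (f g : 'rV[R]_d -> C) (X P : 'rV[R]_d) : C :=
  RtoC ((2 * pi * eta) ^- d) *
  rintC (fun Y : 'rV[R]_d =>
           expi (- dotv P Y / eta) * f (X + 2^-1 *: Y) * conjc (g (X - 2^-1 *: Y))).

Definition Wfun (eta : R) (n : nat) (phi : 'rV[R]_n -> C) (z : 'rV[R]_(n + n)) : C :=
  wigner eta phi phi (lsubmx z) (rsubmx z).

(** (Op^W_eta(a) psi | psi)_{L^2} = \int a W_eta psi, for a in L^2(R^{2n}) *)
Definition weyl_quad (eta : R) (n : nat) (a : 'rV[R]_(n + n) -> R)
  (psi : 'rV[R]_n -> C) : C :=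
  rintC (fun z => RtoC (a z) * Wfun eta psi z).

Definition weyl_nonneg (eta : R) (n : nat) (a : 'rV[R]_(n + n) -> R) : Prop :=
  forall psi : 'rV[R]_n -> C, L2 psi -> 0 <= weyl_quad eta a psi.

Definition heis (eta : R) (n : nat) (z0 : 'rV[R]_(n + n)) (psi : 'rV[R]_n -> C)
  (x : 'rV[R]_n) : C :=
  expi ((dotv (rsubmx z0) x - 2^-1 * dotv (rsubmx z0) (lsubmx z0)) / eta) *
  psi (x - lsubmx z0).

Definition gabor_frame (eta : R) (n : nat) (phi : 'rV[R]_n -> C)
  (Lam : set 'rV[R]_(n + n)) : Prop :=
  exists A B : R, 0 < A /\ A <= B /\
    forall f : 'rV[R]_n -> C, L2 f ->
      (A%:E * norm2 f <= \esum_(l in Lam) (cabs2 (ip f (heis eta l phi)))%:E)%E /\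
      (\esum_(l in Lam) (cabs2 (ip f (heis eta l phi)))%:E <= B%:E * norm2 f)%E.

Definition is_lattice (n : nat) (Lam : set 'rV[R]_(n + n)) : Prop :=
  exists M : 'M[R]_(n + n), M \in unitmx /\
    Lam = range (fun k : 'I_(n + n) -> int => (\row_i (k i)%:~R) *m M).

Definition latball (n : nat) (Lam : set 'rV[R]_(n + n)) (N : nat) : set 'rV[R]_(n + n) :=
  [set l | Lam l /\ Num.sqrt (dotv l l) <= N%:R].

Definition psd_on (n : nat) (S : set 'rV[R]_(n + n))
  (Mx : 'rV[R]_(n + n) -> 'rV[R]_(n + n) -> C) : Prop :=
  forall zeta : 'rV[R]_(n + n) -> C,
    0 <= \sum_(l \in S) \sum_(m \in S) zeta l * conjc (zeta m) * Mx l m.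

Definition Mcoef (eta : R) (n : nat) (a : 'rV[R]_(n + n) -> R) (phi : 'rV[R]_n -> C)
  (l m : 'rV[R]_(n + n)) : C :=
  expi (- sympl l m / (2 * eta)) *
  rintC (fun z => expi (- sympl z (l - m) / eta) * RtoC (a z) *
                  Wfun eta phi (z - 2^-1 *: (l + m))).

Definition Mcoef' (eta : R) (n : nat) (a : 'rV[R]_(n + n) -> R) (phi : 'rV[R]_n -> C)
  (l m : 'rV[R]_(n + n)) : C :=
  wigner eta (fun z => RtoC (a z)) (fun z => Wfun eta phi (- z))
    (4^-1 *: (l + m)) (2^-1 *: Jmap (m - l)).

End Defs.

(* Main.v *)
Require Import Defs.
From HB Require Import structures.
From mathcomp Require Import all_boot all_order all_algebra.
From mathcomp Require Import finmap all_classical all_reals all_analysis.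
From mathcomp Require Import measurable_realfun complex.
From mathcomp Require Import ring lra zify.
Set Implicit Arguments.
Unset Strict Implicit.
Unset Printing Implicit Defensive.
Import Order.TTheory GRing.Theory Num.Theory.
Import numFieldNormedType.Exports.
Local Open Scope classical_set_scope.
Local Open Scope ring_scope.

(** The form [f |-> \int a W f] is the diagonal of the Hermitian form
    [B (f, g) = \int a W (f, g)], and covariance of the Wigner transform under
    displacements gives [M_(l, m) = B (T_l phi, T_m phi)].  Hence all [M_(N)] are
    positive semidefinite iff [B] is nonnegative on finite combinations of Gabor
    atoms.  These are dense: one relaxed analysis-synthesis step multiplies the
    squared norm of the residual by at most [1 - A / (2 * B)].  The form is
    continuous because [W] is bounded from [L^2 x L^2] to [L^2]; for this a Bessel
    inequality for the Fourier transform suffices.  In one variable it follows by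
    weighting [|h^(p)|^2] with [exp (- e |p|)], whose Fourier transform is a
    positive kernel with mass independent of [e], and letting [e] tend to 0; then
    one argues coordinate by coordinate.  Finally the substitution
    [z = X + Y / 2] turns [M'] into a positive multiple of [M]. *)

(** * Lebesgue measure on row vectors *)

(** The definitions integrate one coordinate at a time, and such an iterated integral takes default
    values where a slice is not integrable. A measure [vol d] is therefore built by the same
    recursion, and [rintC_Cint] identifies the two integrals on integrable functions; every estimate
    is then made for [vol d].

    Integrability of [h] gives no decay of its transform, so the order of integration in the
    integral of |h^(p)|^2 cannot be exchanged directly. The exponential weight makes the triple
    integral absolutely convergent, and both its transform and the mass of that transform come from
    explicit antiderivatives.

    The Bessel inequality asks only for an integrable function and allows infinite norms. This fits
    the Wigner transform: for every [X], the function of [Y] that is transformed is a product of two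
    square integrable functions, hence integrable, while its own square integral may be infinite.

    Positivity passes to the limit by contradiction: if the form is negative at [f] but nonnegative
    at the approximants, its square at [f] is at most a constant times q^k for every k, with q < 1.
    Apart from q, constants only have to be finite. *)

Section RowMeasurable.
Variables (R : realType) (d : nat).

Definition row_of_tuple (t : d.-tuple R) : 'rV[R]_d := \row_i tnth t i.

(** The sigma-algebra is transported from tuples because [rmeas] tests measurability through tuples;
    with this choice [rmeas] is ordinary measurability of real and imaginary parts ([rmeasE]). *)
Definition row_measurable : set (set 'rV[R]_d) :=
  [set A | measurable (row_of_tuple @^-1` A)].

Lemma row_measurable0 : row_measurable set0.
Proof. by rewrite /row_measurable /= preimage_set0. Qed.

Lemma row_measurableC A : row_measurable A -> row_measurable (~` A).
Proof. by rewrite /row_measurable /= preimage_setC; exact: measurableC. Qed.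

Lemma row_measurable_bigcup (F : (set 'rV[R]_d)^nat) :
  (forall i, row_measurable (F i)) -> row_measurable (\bigcup_i F i).
Proof.
by rewrite /row_measurable /= => mF; rewrite preimage_bigcup; exact: bigcupT_measurable.
Qed.

HB.instance Definition _ := @isMeasurable.Build default_measure_display
  'rV[R]_d row_measurable row_measurable0 row_measurableC row_measurable_bigcup.

End RowMeasurable.

Section RowMeasurableFun.
Context (R : realType) (d : nat).

Lemma measurable_row_of_tuple : measurable_fun setT (@row_of_tuple R d).
Proof. by move=> _ A mA; rewrite setTI. Qed.

Lemma measurable_fun_rowE dT (T : measurableType dT) (f : 'rV[R]_d -> T) :
  measurable_fun setT f <-> measurable_fun setT (f \o @row_of_tuple R d).
Proof.
split=> mf.
  exact: measurableT_comp mf measurable_row_of_tuple.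
move=> _ A mA; rewrite setTI.
by have := mf measurableT A mA; rewrite setTI.
Qed.

Lemma measurable_coord (i : 'I_d) : measurable_fun setT (fun v : 'rV[R]_d => v ord0 i).
Proof.
apply/measurable_fun_rowE.
rewrite [X in measurable_fun _ X](_ : _ = (@tnth d R)^~ i); first exact: measurable_tnth.
by apply/funext => t /=; rewrite mxE.
Qed.

Lemma measurable_fun_row dT (T : measurableType dT) (f : T -> 'rV[R]_d) :
  (forall i, measurable_fun setT (fun x => f x ord0 i)) -> measurable_fun setT f.
Proof.
move=> mf; pose g x := [tuple f x ord0 i | i < d].
have mg : measurable_fun setT g.
  apply/measurable_fun_tnthP => i.
  rewrite [X in measurable_fun _ X](_ : _ = fun x => f x ord0 i)//.
  by apply/funext => x /=; rewrite tnth_mktuple.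
rewrite (_ : f = @row_of_tuple R d \o g); first exact: measurableT_comp measurable_row_of_tuple mg.
by apply/funext => x; apply/rowP => i /=; rewrite mxE tnth_mktuple.
Qed.

End RowMeasurableFun.

Section Cons.
Context (R : realType) (d : nat).

(** The vector counterpart of [x :: s] in [iintC] and [iintE]: one unfolding of an iterated integral
    becomes an integration over a product of the line with a space of one dimension less. *)
Definition consv (p : measurableTypeR R * 'rV[R]_d) : 'rV[R]_d.+1 :=
  \row_i (if unlift ord0 i is Some j then p.2 ord0 j else p.1).

Definition unconsv (v : 'rV[R]_d.+1) : measurableTypeR R * 'rV[R]_d :=
  (v ord0 ord0, \row_j v ord0 (lift ord0 j)).

Lemma consv0 p : consv p ord0 ord0 = p.1.
Proof. by rewrite mxE unlift_none. Qed.

Lemma consvS p j : consv p ord0 (lift ord0 j) = p.2 ord0 j.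
Proof. by rewrite mxE liftK. Qed.

Lemma consvK : cancel consv unconsv.
Proof.
move=> [x v]; rewrite /unconsv consv0; congr pair.
by apply/rowP => j; rewrite mxE consvS.
Qed.

Lemma unconsvK : cancel unconsv consv.
Proof.
move=> v; apply/rowP => i; case: (unliftP ord0 i) => [j|] ->.
  by rewrite consvS mxE.
by rewrite consv0.
Qed.

Lemma measurable_consv : measurable_fun setT consv.
Proof.
apply: measurable_fun_row => i; case: (unliftP ord0 i) => [j|] ->.
  under eq_fun do rewrite consvS.
  exact: measurableT_comp (measurable_coord j) measurable_snd.
under eq_fun do rewrite consv0.
exact: measurable_fst.
Qed.

Lemma measurable_unconsv : measurable_fun setT unconsv.
Proof.
apply: measurable_fun_pair; first exact: measurable_coord.
apply: measurable_fun_row => i.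
under eq_fun do rewrite mxE.
exact: measurable_coord.
Qed.

Lemma consvD p q : consv p + consv q = consv (p.1 + q.1, p.2 + q.2).
Proof.
apply/rowP => i; rewrite mxE; case: (unliftP ord0 i) => [j|] ->.
  by rewrite !consvS mxE.
by rewrite !consv0.
Qed.

Lemma consvZ c p : c *: consv p = consv (c * p.1, c *: p.2).
Proof.
apply/rowP => i; rewrite mxE; case: (unliftP ord0 i) => [j|] ->.
  by rewrite !consvS mxE.
by rewrite !consv0.
Qed.

Lemma vec_of_seq_cons x s : vec_of_seq d.+1 (x :: s) = consv (x, vec_of_seq d s).
Proof.
apply/rowP => i; rewrite mxE; case: (unliftP ord0 i) => [j|] ->.
  by rewrite consvS mxE.
by rewrite consv0.
Qed.

Lemma dotv_consv p q : dotv (consv p) (consv q) = p.1 * q.1 + dotv p.2 q.2.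
Proof.
rewrite /dotv big_ord_recl !consv0; congr (_ + _).
by apply: eq_bigr => i _; rewrite !consvS.
Qed.

End Cons.

(* The sigma-finiteness of [m1 \x m2] that the library proves is not found by
   inference: the instance for subprobabilities shadows it. *)
Section ProductSigmaFinite.
Context d1 d2 (T1 : measurableType d1) (T2 : measurableType d2) (R : realType).
Variables (m1 : {sigma_finite_measure set T1 -> \bar R})
  (m2 : {sigma_finite_measure set T2 -> \bar R}).

Definition prodm : set (T1 * T2) -> \bar R := (m1 \x m2)%E.

HB.instance Definition _ := Measure.copy prodm (m1 \x m2)%E.

Let prodm_sigma_finite : sigma_finite setT prodm.
Proof.
have /sigma_finiteP[F [TF ndF mF]] := sigma_finiteT m1.
have /sigma_finiteP[G [TG ndG mG]] := sigma_finiteT m2.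
exists (fun i => F i `*` G i); last first.
  move=> i; have [mFi Fi] := mF i; have [mGi Gi] := mG i.
  split; first exact: measurableX.
  by rewrite /prodm product_measure1E// lte_mul_pinfty// ge0_fin_numE.
apply/esym/seteqP; split=> // -[x y] _.
have [i _ Fx] : (\bigcup_i F i) x by rewrite -TF.
have [j _ Gy] : (\bigcup_i G i) y by rewrite -TG.
(* Both exhaustions increase, so the larger index serves for the two coordinates at once. *)
exists (maxn i j) => //; split => /=.
  by move/subsetPset: (ndF _ _ (leq_maxl i j)); apply.
by move/subsetPset: (ndG _ _ (leq_maxr i j)); apply.
Qed.

HB.instance Definition _ := Measure_isSigmaFinite.Build _ _ _ prodm prodm_sigma_finite.

End ProductSigmaFinite.

Section Tonelli.
Context d1 d2 (T1 : measurableType d1) (T2 : measurableType d2) (R : realType).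
Variables (m1 : {sigma_finite_measure set T1 -> \bar R})
  (m2 : {sigma_finite_measure set T2 -> \bar R}).
Variable f : T1 -> T2 -> \bar R.
Hypothesis mf : measurable_fun setT (fun p : T1 * T2 => f p.1 p.2).

Lemma measurable_curry1 x : measurable_fun setT (f x).
Proof.
exact: (measurableT_comp mf (measurable_fun_pair (measurable_cst x) (@measurable_id _ _ setT))).
Qed.

Hypothesis f0 : forall x y, (0 <= f x y)%E.

Lemma measurable_ge0_integral : measurable_fun setT (fun x => \int[m2]_y f x y)%E.
Proof. by apply: (measurable_fun_fubini_tonelli_F _ mf) => p; exact: f0. Qed.

Lemma ge0_integral_swap :
  (\int[m1]_x \int[m2]_y f x y = \int[m2]_y \int[m1]_x f x y)%E.
Proof. by apply: (fubini_tonelli _ mf) => p; exact: f0. Qed.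

End Tonelli.

Section Vol.
Context (R : realType).
Local Notation leb := (@lebesgue_measure R).

Section VolS.
Variables (d : nat) (m : {sigma_finite_measure set 'rV[R]_d -> \bar R}).

Definition volS : set 'rV[R]_d.+1 -> \bar R := pushforward (prodm leb m) (@consv R d).

Let volS_meas : {measure set 'rV[R]_d.+1 -> \bar R} :=
  measure_function_pushforward__canonical__measure_function_Measure
    (prodm leb m) (@measurable_consv R d).

Let volS0 : volS set0 = 0%E. Proof. exact: (measure0 volS_meas). Qed.
Let volS_ge0 A : (0 <= volS A)%E. Proof. exact: (measure_ge0 volS_meas). Qed.
Let volS_sigma_additive : semi_sigma_additive volS.
Proof. exact: (@measure_semi_sigma_additive _ _ _ volS_meas). Qed.

HB.instance Definition _ := isMeasure.Build _ _ _ volS volS0 volS_ge0 volS_sigma_additive.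

Let volS_sigma_finite : sigma_finite setT volS.
Proof.
have [F TF mF] := sigma_finiteT (prodm leb m).
exists (fun i => (@unconsv R d) @^-1` (F i)).
  by rewrite -preimage_bigcup -TF preimage_setT.
move=> i; split.
  rewrite -[X in measurable X]setTI.
  by apply: measurable_unconsv => //; exact: (mF i).1.
rewrite /volS /pushforward -comp_preimage (_ : _ \o _ = id) ?preimage_id; first exact: (mF i).2.
by apply/funext => p /=; rewrite consvK.
Qed.

HB.instance Definition _ := Measure_isSigmaFinite.Build _ _ _ volS volS_sigma_finite.
End VolS.

(** Lebesgue measure, by the recursion of [iintC] and [iintE], so that comparing them takes one
    application of Fubini or Tonelli per coordinate. The Dirac mass in dimension 0 reproduces the
    value [f [::]]. *)
Fixpoint vol (d : nat) : {sigma_finite_measure set 'rV[R]_d -> \bar R} :=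
  match d with
  | 0 => \d_(0 : 'rV[R]_0)
  | d'.+1 => volS (vol d')
  end.

Lemma ge0_integral_vol0 (F : 'rV[R]_0 -> \bar R) : measurable_fun setT F ->
  (\int[vol 0]_v F v = F 0%R)%E.
Proof. by move=> mF; rewrite /= integral_dirac// diracT mul1e. Qed.

Lemma ge0_integral_volS d (F : 'rV[R]_d.+1 -> \bar R) :
  measurable_fun setT F -> (forall v, 0 <= F v)%E ->
  (\int[vol d.+1]_v F v = \int[leb]_x \int[vol d]_v F (consv (x, v)))%E.
Proof.
move=> mF F0.
transitivity (\int[pushforward (prodm leb (vol d)) (@consv R d)]_v F v)%E; first by [].
rewrite (ge0_integral_pushforward (@measurable_consv R d) _ measurableT mF)//.
rewrite preimage_setT /prodm fubini_tonelli1//=.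
exact: measurableT_comp mF (@measurable_consv R d).
Qed.

End Vol.

(** * Affine changes of variables *)

Section Affine.
Context (R : realType).
Local Notation leb := (@lebesgue_measure R).

Lemma measurable_affine1 (c b : R) : measurable_fun setT (fun x : R => c * x + b).
Proof. by apply: measurable_funD => //; exact: measurable_funM. Qed.

(** Both sides are measures in [A], and Lebesgue measure is determined by its values on half-open
    intervals. For negative [c] the preimage is closed at the other end, which leaves its length
    unchanged. *)
Lemma lebesgue_measure_affine (c b : R) (A : set R) : c != 0 -> measurable A ->
  leb A = (`|c|%:E * leb ((fun x => c * x + b)%R @^-1` A))%E.
Proof.
move=> c0 mA.
pose f : R -> measurableTypeR R := fun x => c * x + b.
have mf : measurable_fun setT f by exact: measurable_affine1.
pose P := measure_function_pushforward__canonical__measure_function_Measure leb mf.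
have cn : 0 <= `|c| by [].
pose m' := mscale (NngNum cn) P.
have -> : leb A = m' A; last by [].
apply: lebesgue_measure_unique => // _ [[a e]] _ <-.
transitivity (`|c|%:E * leb (f @^-1` `]a, e]%classic))%E; last by [].
have [c_gt0|c_lt0|c00] := ltgtP 0 c; last by rewrite c00 eqxx in c0.
- rewrite (_ : f @^-1` _ = `](a - b) / c, (e - b) / c]%classic).
    rewrite !lebesgue_measure_itv/= !lte_fin ltr_pM2r ?invr_gt0// ltrD2r.
    case: ifPn => _; last by rewrite mule0.
    rewrite -!EFinB -EFinM gtr0_norm//; congr EFin; field; lra.
  apply/seteqP; split => x /=; rewrite !in_itv /= /f.
    by rewrite ltr_pdivrMr// ler_pdivlMr// => /andP[? ?]; apply/andP; split; lra.
  by rewrite ltr_pdivrMr// ler_pdivlMr// => /andP[? ?]; apply/andP; split; lra.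
- rewrite (_ : f @^-1` _ = `[(e - b) / c, (a - b) / c[%classic).
    rewrite !lebesgue_measure_itv/= !lte_fin ltr_nM2r ?invr_lt0// ltrD2r.
    case: ifPn => _; last by rewrite mule0.
    rewrite -!EFinB -EFinM ltr0_norm//; congr EFin; field; lra.
  apply/seteqP; split => x /=; rewrite !in_itv /= /f.
    by rewrite ltr_ndivlMr// ler_ndivrMr// => /andP[? ?]; apply/andP; split; lra.
  by rewrite ltr_ndivlMr// ler_ndivrMr// => /andP[? ?]; apply/andP; split; lra.
Qed.

Lemma ge0_integral_affine1 (c b : R) (f : R -> \bar R) : c != 0 ->
  measurable_fun setT f -> (forall x, 0 <= f x)%E ->
  (\int[leb]_x f x = `|c|%:E * \int[leb]_x f (c * x + b)%R)%E.
Proof.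
move=> c0 mf f0.
pose g : R -> measurableTypeR R := fun x => c * x + b.
have mg : measurable_fun setT g by exact: measurable_affine1.
pose P := measure_function_pushforward__canonical__measure_function_Measure leb mg.
have cn : 0 <= `|c| by [].
have -> : (\int[leb]_x f x = \int[mscale (NngNum cn) P]_x f x)%E.
  apply: eq_measure_integral => A mA _.
  exact: (lebesgue_measure_affine b c0 mA).
rewrite ge0_integral_mscale//=; congr (_ * _)%E.
rewrite ge0_integral_pushforward//.
Qed.

Lemma measurable_addv d dT (T : measurableType dT) (f g : T -> 'rV[R]_d) :
  measurable_fun setT f -> measurable_fun setT g -> measurable_fun setT (fun x => f x + g x).
Proof.
move=> mf mg; apply: measurable_fun_row => i; under eq_fun do rewrite mxE.
by apply: measurable_funD; exact: measurableT_comp (measurable_coord i) _.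
Qed.

Lemma measurable_scalev d dT (T : measurableType dT) (c : R) (f : T -> 'rV[R]_d) :
  measurable_fun setT f -> measurable_fun setT (fun x => c *: f x).
Proof.
move=> mf; apply: measurable_fun_row => i; under eq_fun do rewrite mxE.
apply: measurable_funM => //; exact: measurableT_comp (measurable_coord i) _.
Qed.

Lemma measurable_oppv d dT (T : measurableType dT) (f : T -> 'rV[R]_d) :
  measurable_fun setT f -> measurable_fun setT (fun x => - f x).
Proof.
by move=> mf; under eq_fun do rewrite -scaleN1r; exact: measurable_scalev.
Qed.

Lemma measurable_subv d dT (T : measurableType dT) (f g : T -> 'rV[R]_d) :
  measurable_fun setT f -> measurable_fun setT g -> measurable_fun setT (fun x => f x - g x).
Proof. by move=> mf mg; apply: measurable_addv => //; exact: measurable_oppv. Qed.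

Lemma measurable_row_mx n m dT (T : measurableType dT) (f : T -> 'rV[R]_n) (g : T -> 'rV[R]_m) :
  measurable_fun setT f -> measurable_fun setT g ->
  measurable_fun setT (fun x => row_mx (f x) (g x)).
Proof.
move=> mf mg; apply: measurable_fun_row => i.
case: (split_ordP i) => j ->.
  by under eq_fun do rewrite row_mxEl; exact: measurableT_comp (measurable_coord j) _.
by under eq_fun do rewrite row_mxEr; exact: measurableT_comp (measurable_coord j) _.
Qed.

Lemma measurable_lsubmx n m : measurable_fun setT (fun z : 'rV[R]_(n + m) => lsubmx z).
Proof.
by apply: measurable_fun_row => i; under eq_fun do rewrite mxE; exact: measurable_coord.
Qed.

Lemma measurable_rsubmx n m : measurable_fun setT (fun z : 'rV[R]_(n + m) => rsubmx z).
Proof.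
by apply: measurable_fun_row => i; under eq_fun do rewrite mxE; exact: measurable_coord.
Qed.

Lemma measurable_dotv d dT (T : measurableType dT) (f g : T -> 'rV[R]_d) :
  measurable_fun setT f -> measurable_fun setT g ->
  measurable_fun setT (fun x => dotv (f x) (g x)).
Proof.
move=> mf mg; apply: measurable_sum => i.
by apply: measurable_funM; exact: measurableT_comp (measurable_coord i) _.
Qed.

(** Scalar dilations act on each coordinate separately, so induction gives one factor [|c|] per
    coordinate without any determinant. Translations, reflections and the factors 2 and 1/2 are all
    that Wigner transforms require. *)
Lemma ge0_integral_vol_affine d (c : R) (b : 'rV[R]_d) (F : 'rV[R]_d -> \bar R) :
  c != 0 -> measurable_fun setT F -> (forall v, 0 <= F v)%E ->
  (\int[vol R d]_v F v = (`|c| ^+ d)%:E * \int[vol R d]_v F (c *: v + b)%R)%E.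
Proof.
move=> c0; elim: d b F => [|d IH] b F mF F0.
  rewrite !ge0_integral_vol0//= ?mul1e; last first.
    apply: measurableT_comp mF _; apply: measurable_addv => //; exact: measurable_scalev.
  by congr F; apply/rowP => -[].
have mF' : measurable_fun setT (fun v : 'rV[R]_d.+1 => F (c *: v + b)).
  by apply: measurableT_comp mF _; apply: measurable_addv => //; exact: measurable_scalev.
rewrite !ge0_integral_volS//.
have [b1 [b2 ->]] : exists b1 b2, b = consv (b1, b2).
  by exists (unconsv b).1, (unconsv b).2; rewrite -surjective_pairing unconsvK.
have mFc : measurable_fun setT (fun p : measurableTypeR R * 'rV[R]_d => F (consv p)).
  exact: measurableT_comp mF (@measurable_consv R d).
have mFx (x : measurableTypeR R) : measurable_fun setT (fun v : 'rV[R]_d => F (consv (x, v))).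
  exact: measurableT_comp mFc (measurable_fun_pair (measurable_cst x) (@measurable_id _ _ setT)).
transitivity (\int[leb]_x ((`|c| ^+ d)%:E * \int[vol R d]_v F (consv (x, c *: v + b2)%R)))%E.
  by apply: eq_integral => x _; rewrite (IH b2).
have mG : measurable_fun setT (fun p : measurableTypeR R * 'rV[R]_d => F (consv (p.1, c *: p.2 + b2)%R)).
  apply: measurableT_comp mFc _; apply: measurable_fun_pair => //.
  by apply: measurable_addv => //; exact: measurable_scalev.
have mH : measurable_fun setT (fun x : measurableTypeR R => \int[vol R d]_v F (consv (x, c *: v + b2)%R))%E.
  exact: (measurable_ge0_integral (vol R d) mG).
have cd0 : 0 <= `|c| ^+ d by rewrite exprn_ge0.
have H0 (x : measurableTypeR R) : (0 <= \int[vol R d]_v F (consv (x, c *: v + b2)%R))%E.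
  by apply: integral_ge0 => v _; exact: F0.
rewrite (ge0_integralZl_EFin leb measurableT (fun x _ => H0 x) mH cd0).
have -> := ge0_integral_affine1 b1 c0 mH H0.
rewrite muleA -EFinM -exprSr; congr (_ * _)%E.
apply: eq_integral => x _; apply: eq_integral => v _.
by rewrite consvZ consvD.
Qed.

End Affine.

(** * Complex-valued integrals *)

Section ComplexScalars.
Context (R : realType).
Local Notation C := R[i].
Implicit Types (z w : C) (x t : R).

(** A substitute for the modulus that avoids square roots and splits additively into the two real
    parts. It is submultiplicative, and its square lies between [cabs2] and twice [cabs2]. *)
Definition cnorm1 z : R := `|complex.Re z| + `|complex.Im z|.

Lemma cReD z w : complex.Re (z + w) = complex.Re z + complex.Re w.
Proof. by case: z; case: w. Qed.
Lemma cImD z w : complex.Im (z + w) = complex.Im z + complex.Im w.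
Proof. by case: z; case: w. Qed.
Lemma cReN z : complex.Re (- z) = - complex.Re z. Proof. by case: z. Qed.
Lemma cImN z : complex.Im (- z) = - complex.Im z. Proof. by case: z. Qed.
Lemma cReM z w : complex.Re (z * w) =
  complex.Re z * complex.Re w - complex.Im z * complex.Im w.
Proof. by case: z; case: w. Qed.
Lemma cImM z w : complex.Im (z * w) =
  complex.Re z * complex.Im w + complex.Im z * complex.Re w.
Proof. by case: z; case: w. Qed.
Lemma cReJ z : complex.Re (conjc z) = complex.Re z. Proof. by case: z. Qed.
Lemma cImJ z : complex.Im (conjc z) = - complex.Im z. Proof. by case: z. Qed.

Definition ReImE := (cReD, cImD, cReN, cImN, cReM, cImM, cReJ, cImJ).

Lemma complex_eqP z w : complex.Re z = complex.Re w -> complex.Im z = complex.Im w -> z = w.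
Proof. by case: z => ? ?; case: w => ? ? /= -> ->. Qed.

Lemma conjM z w : conjc (z * w) = conjc z * conjc w.
Proof. exact: rmorphM. Qed.

Lemma conj_RtoC x : conjc (RtoC x) = RtoC x.
Proof. by apply: complex_eqP => //=; rewrite oppr0. Qed.

Lemma RtoCM x y : RtoC (x * y) = RtoC x * RtoC y.
Proof. by apply: complex_eqP => /=; ring. Qed.

Lemma RtoC1 : RtoC (1 : R) = 1.
Proof. by []. Qed.

Lemma RtoC0 : RtoC (0 : R) = 0.
Proof. by []. Qed.

Lemma expiD s t : expi (s + t) = expi s * expi t.
Proof. by apply: complex_eqP; rewrite ?cReM ?cImM /= ?cosD ?sinD //; ring. Qed.

Lemma expi0 : expi (0 : R) = 1.
Proof. by rewrite /expi cos0 sin0. Qed.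

Lemma conjc_expi t : conjc (expi t) = expi (- t).
Proof. by rewrite /expi /= cosN sinN. Qed.

Lemma cabs2M z w : cabs2 (z * w) = cabs2 z * cabs2 w.
Proof. by rewrite /cabs2 cReM cImM; ring. Qed.

Lemma cabs2J z : cabs2 (conjc z) = cabs2 z.
Proof. by rewrite /cabs2 cReJ cImJ; ring. Qed.

Lemma cabs2N z : cabs2 (- z) = cabs2 z.
Proof. by rewrite /cabs2 cReN cImN; ring. Qed.

Lemma cabs2_expi t : cabs2 (expi t) = 1.
Proof. by rewrite /cabs2 /= cos2Dsin2. Qed.

Lemma cabs2_RtoC x : cabs2 (RtoC x) = x ^+ 2.
Proof. by rewrite /cabs2 /=; ring. Qed.

Lemma cabs2_ge0 z : 0 <= cabs2 z.
Proof. by rewrite addr_ge0// sqr_ge0. Qed.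

Lemma mulcJ z : z * conjc z = RtoC (cabs2 z).
Proof. by rewrite /cabs2; apply: complex_eqP; rewrite ?ReImE/=; ring. Qed.

Lemma cabs2D_le z w : cabs2 (z + w) <= 2 * (cabs2 z + cabs2 w).
Proof.
rewrite /cabs2 !ReImE.
have := sqr_ge0 (complex.Re z - complex.Re w).
have := sqr_ge0 (complex.Im z - complex.Im w).
rewrite !expr2; nra.
Qed.

Lemma cnorm1_ge0 z : 0 <= cnorm1 z.
Proof. by rewrite addr_ge0. Qed.

Lemma cnorm1M z w : cnorm1 (z * w) <= cnorm1 z * cnorm1 w.
Proof.
rewrite /cnorm1 cReM cImM mulrDr !mulrDl -!normrM.
apply: (le_trans (lerD (ler_normB _ _) (ler_normD _ _))).
by rewrite -subr_ge0; set u := (X in 0 <= X); rewrite (_ : u = 0)// /u; ring.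
Qed.

Lemma cabs2_le_cnorm1 z : cabs2 z <= cnorm1 z ^+ 2.
Proof.
rewrite /cabs2 /cnorm1 -(real_normK (num_real (complex.Re z))) -(real_normK (num_real (complex.Im z))).
have := mulr_ge0 (normr_ge0 (complex.Re z)) (normr_ge0 (complex.Im z)).
rewrite !expr2; lra.
Qed.

Lemma cnorm1_le_cabs2 z : cnorm1 z ^+ 2 <= 2 * cabs2 z.
Proof.
rewrite /cabs2 /cnorm1 -(real_normK (num_real (complex.Re z))) -(real_normK (num_real (complex.Im z))).
have := sqr_ge0 (`|complex.Re z| - `|complex.Im z|).
rewrite !expr2; lra.
Qed.

Lemma cnorm1_expi t : cnorm1 (expi t) <= 2.
Proof.
rewrite /cnorm1 /=; have := cos_geN1 t; have := cos_le1 t.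
have := sin_geN1 t; have := sin_le1 t => ? ? ? ?.
have ? : `|cos t| <= 1 by rewrite ler_norml; apply/andP; split; lra.
have ? : `|sin t| <= 1 by rewrite ler_norml; apply/andP; split; lra.
lra.
Qed.

Lemma cnorm1M_le_cabs2 z w : cnorm1 (z * w) <= cabs2 z + cabs2 w.
Proof.
apply: (le_trans (cnorm1M z w)).
have := cnorm1_le_cabs2 z; have := cnorm1_le_cabs2 w.
have := sqr_ge0 (cnorm1 z - cnorm1 w); rewrite !expr2; lra.
Qed.

Lemma Re_le_cnorm1 z : `|complex.Re z| <= cnorm1 z.
Proof. by rewrite lerDl. Qed.

Lemma Im_le_cnorm1 z : `|complex.Im z| <= cnorm1 z.
Proof. by rewrite lerDr. Qed.

End ComplexScalars.

Section ComplexMeasurable.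
Context (R : realType) d (T : measurableType d).
Local Notation C := R[i].
Implicit Types f g : T -> C.

Definition cmeas f : Prop :=
  measurable_fun setT (fun x => complex.Re (f x)) /\
  measurable_fun setT (fun x => complex.Im (f x)).

Lemma cmeas_cst (c : C) : cmeas (fun=> c).
Proof. by split; exact: measurable_cst. Qed.

Lemma cmeasD f g : cmeas f -> cmeas g -> cmeas (fun x => f x + g x).
Proof.
move=> [rf jf] [rg jg]; split.
  by under eq_fun do rewrite cReD; exact: measurable_funD.
by under eq_fun do rewrite cImD; exact: measurable_funD.
Qed.

Lemma cmeasM f g : cmeas f -> cmeas g -> cmeas (fun x => f x * g x).
Proof.
move=> [rf jf] [rg jg]; split.
  by under eq_fun do rewrite cReM; apply: measurable_funB; exact: measurable_funM.
by under eq_fun do rewrite cImM; apply: measurable_funD; exact: measurable_funM.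
Qed.

Lemma cmeasJ f : cmeas f -> cmeas (fun x => conjc (f x)).
Proof.
move=> [rf jf]; split.
  by under eq_fun do rewrite cReJ.
by under eq_fun do rewrite cImJ; exact: measurable_funN.
Qed.

Lemma cmeas_expi (f : T -> R) : measurable_fun setT f -> cmeas (fun x => expi (f x)).
Proof.
move=> mf; split => /=.
  by apply: measurableT_comp mf; apply: continuous_measurable_fun; exact: continuous_cos.
by apply: measurableT_comp mf; apply: continuous_measurable_fun; exact: continuous_sin.
Qed.

Lemma measurable_cabs2 f : cmeas f -> measurable_fun setT (fun x => cabs2 (f x)).
Proof. by move=> [rf jf]; apply: measurable_funD; exact: measurable_funX. Qed.

Lemma measurable_cnorm1 f : cmeas f -> measurable_fun setT (fun x => cnorm1 (f x)).
Proof. by move=> [rf jf]; apply: measurable_funD; exact: measurableT_comp. Qed.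

End ComplexMeasurable.

Lemma cmeas_comp (R : realType) d1 d2 (T1 : measurableType d1) (T2 : measurableType d2)
  (f : T2 -> R[i]) (g : T1 -> T2) :
  cmeas f -> measurable_fun setT g -> cmeas (fun x => f (g x)).
Proof. by move=> [rf jf] mg; split; [exact: measurableT_comp rf mg|exact: measurableT_comp jf mg]. Qed.

Section RealIntegrands.
Context (R : realType) d (T : measurableType d) (m : {measure set T -> \bar R}).
Implicit Types f g : T -> R.

Lemma ge0_le_integralR f g : (forall x, 0 <= f x) -> (forall x, f x <= g x) ->
  measurable_fun setT f -> measurable_fun setT g ->
  (\int[m]_x (f x)%:E <= \int[m]_x (g x)%:E)%E.
Proof.
move=> f0 fg mf mg; apply: ge0_le_integral => //.
- by move=> x _; rewrite lee_fin.
- exact/measurable_EFinP.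
- exact/measurable_EFinP.
- by move=> x _; rewrite lee_fin.
Qed.

Lemma ge0_integralRD f g : (forall x, 0 <= f x) -> (forall x, 0 <= g x) ->
  measurable_fun setT f -> measurable_fun setT g ->
  (\int[m]_x (f x + g x)%:E = \int[m]_x (f x)%:E + \int[m]_x (g x)%:E)%E.
Proof.
move=> f0 g0 mf mg; under eq_integral do rewrite EFinD.
rewrite ge0_integralD//.
- by move=> x _; rewrite lee_fin.
- exact/measurable_EFinP.
- by move=> x _; rewrite lee_fin.
- exact/measurable_EFinP.
Qed.

Lemma ge0_integralRZ (k : R) f : 0 <= k -> (forall x, 0 <= f x) ->
  measurable_fun setT f -> (\int[m]_x (k * f x)%:E = k%:E * \int[m]_x (f x)%:E)%E.
Proof.
move=> k0 f0 mf; under eq_integral do rewrite EFinM.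
rewrite ge0_integralZl_EFin//.
- by move=> x _; rewrite lee_fin.
- exact/measurable_EFinP.
Qed.

Lemma ge0_integralR_ge0 f : (forall x, 0 <= f x) -> (0 <= \int[m]_x (f x)%:E)%E.
Proof. by move=> f0; apply: integral_ge0 => x _; rewrite lee_fin. Qed.

End RealIntegrands.

Section ComplexIntegral.
Context (R : realType) d (T : measurableType d) (m : {measure set T -> \bar R}).
Local Notation C := R[i].
Implicit Types f g : T -> C.

Definition Cint f : C :=
  Complex (Rintegral m setT (fun x => complex.Re (f x)))
          (Rintegral m setT (fun x => complex.Im (f x))).

Definition Cintegrable f : Prop :=
  m.-integrable setT (fun x => (complex.Re (f x))%:E) /\
  m.-integrable setT (fun x => (complex.Im (f x))%:E).

Lemma Cintegrable_cmeas f : Cintegrable f -> cmeas f.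
Proof. by move=> [rf jf]; split; apply/measurable_EFinP; exact: (measurable_int m). Qed.

Lemma CintegrableP f : cmeas f ->
  Cintegrable f <-> (\int[m]_x (cnorm1 (f x))%:E < +oo)%E.
Proof.
move=> mf; have [rf jf] := mf.
have mn (h : T -> R) : measurable_fun setT h -> measurable_fun setT (fun x => `|h x|).
  by move=> mh; exact: measurableT_comp.
split.
  move=> [/integrableP[_ irf] /integrableP[_ ijf]].
  by rewrite ge0_integralRD//; try exact: mn; exact: lte_add_pinfty.
by move=> fi; split; apply/integrableP; split;
  [exact/measurable_EFinP | apply: le_lt_trans fi; apply: ge0_le_integralR => //;
    [by move=> x; exact: Re_le_cnorm1 | exact: mn | exact: measurable_cnorm1]
  | exact/measurable_EFinP | apply: le_lt_trans fi; apply: ge0_le_integralR => //;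
    [by move=> x; exact: Im_le_cnorm1 | exact: mn | exact: measurable_cnorm1]].
Qed.

Lemma Cintegrable_le f (g : T -> R) : cmeas f -> measurable_fun setT g ->
  (forall x, cnorm1 (f x) <= g x) -> (\int[m]_x (g x)%:E < +oo)%E -> Cintegrable f.
Proof.
move=> mf mg fg gi; apply/CintegrableP => //; apply: le_lt_trans gi.
apply: ge0_le_integralR => //; first by move=> x; exact: cnorm1_ge0.
exact: measurable_cnorm1.
Qed.

Lemma CintegrableD f g : Cintegrable f -> Cintegrable g -> Cintegrable (fun x => f x + g x).
Proof.
move=> [rf jf] [rg jg]; split.
  by under eq_fun do rewrite cReD EFinD; exact: integrableD.
by under eq_fun do rewrite cImD EFinD; exact: integrableD.
Qed.

Lemma CintD f g : Cintegrable f -> Cintegrable g ->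
  Cint (fun x => f x + g x) = Cint f + Cint g.
Proof.
move=> [rf jf] [rg jg]; apply: complex_eqP; rewrite ?cReD ?cImD /Cint /=.
  by under eq_Rintegral do rewrite cReD; rewrite RintegralD.
by under eq_Rintegral do rewrite cImD; rewrite RintegralD.
Qed.

Lemma integrable_scaleE (k : R) (h : T -> R) : m.-integrable setT (fun x => (h x)%:E) ->
  m.-integrable setT (fun x => (k * h x)%:E).
Proof. by move=> ih; under eq_fun do rewrite EFinM; exact: integrableZl. Qed.

Lemma CintegrableZ (c : C) f : Cintegrable f -> Cintegrable (fun x => c * f x).
Proof.
move=> [rf jf]; split.
  under eq_fun do rewrite cReM EFinB.
  by apply: integrableB => //; exact: integrable_scaleE.
under eq_fun do rewrite cImM EFinD.
by apply: integrableD => //; exact: integrable_scaleE.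
Qed.

Lemma CintZ (c : C) f : Cintegrable f -> Cint (fun x => c * f x) = c * Cint f.
Proof.
move=> [rf jf]; apply: complex_eqP; rewrite ?cReM ?cImM /Cint /=.
  under eq_Rintegral do rewrite cReM.
  by rewrite RintegralB//= ?RintegralZl//; exact: integrable_scaleE.
under eq_Rintegral do rewrite cImM.
by rewrite RintegralD//= ?RintegralZl//; exact: integrable_scaleE.
Qed.

Lemma Cintegrable0 : Cintegrable (fun=> 0).
Proof. by split; exact: integrable0. Qed.

Lemma Cint0 : Cint (fun=> 0) = 0.
Proof. by apply: complex_eqP; rewrite /= /Rintegral integral0_eq. Qed.

Lemma Cintegrable_sum (I : Type) (s : seq I) (F : I -> T -> C) :
  (forall i, Cintegrable (F i)) -> Cintegrable (fun x => \sum_(i <- s) F i x).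
Proof.
move=> iF; elim: s => [|i s IH].
  by under eq_fun do rewrite big_nil; exact: Cintegrable0.
by under eq_fun do rewrite big_cons; exact: CintegrableD.
Qed.

Lemma Cint_sum (I : Type) (s : seq I) (F : I -> T -> C) :
  (forall i, Cintegrable (F i)) ->
  Cint (fun x => \sum_(i <- s) F i x) = \sum_(i <- s) Cint (F i).
Proof.
move=> iF; elim: s => [|i s IH].
  by under eq_fun do rewrite big_nil; rewrite big_nil Cint0.
under eq_fun do rewrite big_cons.
by rewrite CintD ?IH ?big_cons//; exact: Cintegrable_sum.
Qed.

Lemma CintJ f : Cintegrable f -> Cint (fun x => conjc (f x)) = conjc (Cint f).
Proof.
move=> [rf jf]; apply: complex_eqP; rewrite ?cReJ ?cImJ /Cint /=.
  by under eq_Rintegral do rewrite cReJ.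
under eq_Rintegral do rewrite cImJ -mulN1r.
by rewrite RintegralZl// mulN1r.
Qed.

Lemma cnorm1_Cint_le f : cmeas f ->
  ((cnorm1 (Cint f))%:E <= 2%:E * \int[m]_x (cnorm1 (f x))%:E)%E.
Proof.
move=> mf.
have half (h : T -> R) : measurable_fun setT h -> (forall x, `|h x| <= cnorm1 (f x)) ->
  (`|Rintegral m setT h|%:E <= \int[m]_x (cnorm1 (f x))%:E)%E.
  move=> mh hf.
  have := @le_abse_integral _ _ _ m setT (EFin \o h) measurableT ((measurable_EFinP _ _).2 mh).
  rewrite /Rintegral /= => hle.
  have {}hle : (`|\int[m]_x (h x)%:E| <= \int[m]_x (cnorm1 (f x))%:E)%E.
    apply: (le_trans hle); apply: ge0_le_integralR => //; first exact: measurableT_comp.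
    exact: measurable_cnorm1.
  (* Integrability is not assumed: for an infinite integral [fine] returns 0 and the bound is
     trivial. *)
  apply: le_trans hle; case: (integral _ _ _) => [r| |] //=; rewrite ?normr0 ?leey//.
have [rf jf] := mf.
rewrite /cnorm1 EFinD (_ : 2%:E = 1 + 1)%E; last by rewrite -EFinD.
rewrite ge0_muleDl// !mul1e leeD//.
  by apply: half => // x; exact: Re_le_cnorm1.
by apply: half => // x; exact: Im_le_cnorm1.
Qed.

Definition sqint f : \bar R := (\int[m]_x (cabs2 (f x))%:E)%E.

Definition Lsq f : Prop := cmeas f /\ (sqint f < +oo)%E.

Lemma sqint_ge0 f : (0 <= sqint f)%E.
Proof. by apply: integral_ge0 => x _; rewrite lee_fin cabs2_ge0. Qed.

Lemma LsqM f g : Lsq f -> Lsq g -> Cintegrable (fun x => f x * g x).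
Proof.
move=> [mf nf] [mg ng].
apply: (@Cintegrable_le _ (fun x => cabs2 (f x) + cabs2 (g x))).
- exact: cmeasM.
- by apply: measurable_funD; exact: measurable_cabs2.
- by move=> x; exact: cnorm1M_le_cabs2.
rewrite ge0_integralRD; [exact: lte_add_pinfty| | | |];
  by [move=> x; exact: cabs2_ge0|exact: measurable_cabs2].
Qed.

Lemma LsqD f g : Lsq f -> Lsq g -> Lsq (fun x => f x + g x).
Proof.
move=> [mf nf] [mg ng]; split; first exact: cmeasD.
have mf2 := measurable_cabs2 mf; have mg2 := measurable_cabs2 mg.
apply: (@le_lt_trans _ _ (\int[m]_x (2 * (cabs2 (f x) + cabs2 (g x)))%:E)%E).
  apply: ge0_le_integralR.
  - by move=> x; exact: cabs2_ge0.
  - by move=> x; exact: cabs2D_le.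
  - exact/measurable_cabs2/cmeasD.
  - by apply: measurable_funM => //; exact: measurable_funD.
rewrite ge0_integralRZ//; last 2 first.
- by move=> x; rewrite addr_ge0// cabs2_ge0.
- exact: measurable_funD.
rewrite ge0_integralRD//; try by move=> x; exact: cabs2_ge0.
by rewrite lte_mul_pinfty// lte_add_pinfty.
Qed.

Lemma sqintZ (c : C) f : cmeas f -> sqint (fun x => c * f x) = ((cabs2 c)%:E * sqint f)%E.
Proof.
move=> mf; rewrite /sqint; under eq_integral do rewrite cabs2M.
rewrite ge0_integralRZ ?cabs2_ge0//; first by move=> x; exact: cabs2_ge0.
exact: measurable_cabs2.
Qed.

Lemma LsqZ (c : C) f : Lsq f -> Lsq (fun x => c * f x).
Proof.
move=> [mf nf]; split; first by apply: cmeasM => //; exact: cmeas_cst.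
rewrite sqintZ// lte_mul_pinfty// ?lee_fin ?cabs2_ge0//.
Qed.

Lemma LsqN f : Lsq f -> Lsq (fun x => - f x).
Proof. by move=> fi; under eq_fun do rewrite -mulN1r; exact: LsqZ. Qed.

Lemma LsqJ f : Lsq f -> Lsq (fun x => conjc (f x)).
Proof.
move=> [mf nf]; split; first exact: cmeasJ.
by rewrite /sqint; under eq_integral do rewrite cabs2J.
Qed.

Lemma Lsq0 : Lsq (fun=> 0).
Proof.
split; first exact: cmeas_cst.
rewrite /sqint integral0_eq// => x _.
by rewrite -RtoC0 cabs2_RtoC expr0n.
Qed.

Lemma Lsq_sum (I : Type) (s : seq I) (F : I -> T -> C) :
  (forall i, Lsq (F i)) -> Lsq (fun x => \sum_(i <- s) F i x).
Proof.
move=> iF; elim: s => [|i s IH].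
  by under eq_fun do rewrite big_nil; exact: Lsq0.
by under eq_fun do rewrite big_cons; exact: LsqD.
Qed.

Definition sqn f : R := fine (sqint f).

Lemma sqn_ge0 f : 0 <= sqn f.
Proof. by rewrite fine_ge0// sqint_ge0. Qed.

Lemma sqnE f : Lsq f -> (sqn f)%:E = sqint f.
Proof. by move=> [_ nf]; rewrite fineK// ge0_fin_numE// sqint_ge0. Qed.

(** Cauchy-Schwarz with a lossy constant. The inequality 2ab <= t a^2 + b^2 / t under the integral
    bounds [cnorm1 z] by 2 (t F + G / t) for every t > 0, where F and G are the squared norms; the
    best t would give 4 sqrt (F G), whose square explains the 16. *)
Lemma cabs2_Cint_le f g : Lsq f -> Lsq g ->
  cabs2 (Cint (fun x => f x * g x)) <= 16 * (sqn f * sqn g).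
Proof.
move=> Lf Lg; have [mf nf] := Lf; have [mg ng] := Lg.
set z := Cint _.
have AG (t : R) : 0 < t -> cnorm1 z <= 2 * (t * sqn f + t^-1 * sqn g).
  move=> t0.
  have fgt : ((cnorm1 z)%:E <= 2%:E * \int[m]_x (cnorm1 (f x * g x))%:E)%E.
    by apply: cnorm1_Cint_le; exact: cmeasM.
  rewrite -lee_fin; apply: (le_trans fgt).
  rewrite EFinM lee_pmul2l// EFinD !EFinM !sqnE//.
  have mf2 := measurable_cabs2 mf; have mg2 := measurable_cabs2 mg.
  rewrite /sqint -!ge0_integralRZ ?invr_ge0 ?(ltW t0)//; try by move=> x; exact: cabs2_ge0.
  rewrite -ge0_integralRD; first last.
  - exact: measurable_funM.
  - exact: measurable_funM.
  - by move=> x; rewrite mulr_ge0 ?invr_ge0 ?(ltW t0) ?cabs2_ge0.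
  - by move=> x; rewrite mulr_ge0 ?(ltW t0) ?cabs2_ge0.
  apply: ge0_le_integralR => //; first last.
  - by apply: measurable_funD; exact: measurable_funM.
  - exact/measurable_cnorm1/cmeasM.
  - move=> x; rewrite (le_trans (cnorm1M _ _))//.
  have h1 := cnorm1_le_cabs2 (f x); have h2 := cnorm1_le_cabs2 (g x).
  have tV0 : 0 < t^-1 by rewrite invr_gt0.
  have tV : t * t^-1 = 1 by rewrite divff ?gt_eqF.
  set a := cnorm1 (f x) in h1 *; set b := cnorm1 (g x) in h2 *.
  have h3 : t * a ^+ 2 <= t * (2 * cabs2 (f x)) by rewrite ler_pM2l.
  have h4 : t^-1 * b ^+ 2 <= t^-1 * (2 * cabs2 (g x)) by rewrite ler_pM2l.
  have h5 : 0 <= t^-1 * (t * a - b) ^+ 2 by rewrite mulr_ge0 ?sqr_ge0// ltW.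
  have h6 : t^-1 * (t * a - b) ^+ 2 = t * a ^+ 2 - 2 * (a * b) + t^-1 * b ^+ 2.
      by field; rewrite gt_eqF.
    lra.
  - by move=> x; exact: cnorm1_ge0.
have c0 := cnorm1_ge0 z; have f0 := sqn_ge0 f; have g0 := sqn_ge0 g.
apply: (le_trans (cabs2_le_cnorm1 z)).
have [->|cn0] := eqVneq (cnorm1 z) 0; first by rewrite expr0n/= !mulr_ge0.
have {}c0 : 0 < cnorm1 z by rewrite lt_neqAle eq_sym cn0.
have [F0|Fn0] := eqVneq (sqn f) 0.
  have [G0|Gn0] := eqVneq (sqn g) 0.
    by have := AG 1 ltr01; rewrite F0 G0; lra.
  have Gp : 0 < sqn g by rewrite lt_neqAle eq_sym Gn0.
  (* With F = 0 this t turns the bound into [cnorm1 z <= cnorm1 z / 2], a contradiction. *)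
  have := AG (4 * sqn g / cnorm1 z) (divr_gt0 (mulr_gt0 (ltr0n _ 4) Gp) c0).
  rewrite F0 (_ : _^-1 * _ = cnorm1 z / 4); first lra.
  by field; rewrite !gt_eqF.
have Fp : 0 < sqn f by rewrite lt_neqAle eq_sym Fn0.
(* This t avoids the square root of the optimal one: it makes the first term [cnorm1 z / 2], which
   is absorbed on the left. *)
have := AG (cnorm1 z / (4 * sqn f)) (divr_gt0 c0 (mulr_gt0 (ltr0n _ 4) Fp)).
rewrite (_ : 2 * _ = cnorm1 z / 2 + 8 * (sqn f * sqn g) / cnorm1 z); last first.
  by field; rewrite !gt_eqF.
move=> h; have : cnorm1 z / 2 <= 8 * (sqn f * sqn g) / cnorm1 z by lra.
by rewrite ler_pdivlMr// expr2; lra.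
Qed.

End ComplexIntegral.

(** * Fubini, change of variables and iterated integrals *)

Section Parametric.
Context (R : realType) d1 d2 (T1 : measurableType d1) (T2 : measurableType d2).
Local Notation C := R[i].

Lemma measurable_integral_param (m2 : {sigma_finite_measure set T2 -> \bar R})
    (f : T1 -> T2 -> \bar R) :
  measurable_fun setT (fun p : T1 * T2 => f p.1 p.2) ->
  measurable_fun setT (fun x => \int[m2]_y f x y)%E.
Proof.
move=> mf; under eq_fun do rewrite integralE.
apply: emeasurable_funB.
  refine (@measurable_ge0_integral _ _ _ _ _ m2 (fun x => (f x)^\+%E) _ _) => //.
  by apply: eq_measurable_fun (measurable_funepos mf) => p _; rewrite !funeposE.
refine (@measurable_ge0_integral _ _ _ _ _ m2 (fun x => (f x)^\-%E) _ _) => //.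
by apply: eq_measurable_fun (measurable_funeneg mf) => p _; rewrite !funenegE.
Qed.

Lemma measurable_Rintegral_param (m2 : {sigma_finite_measure set T2 -> \bar R})
    (f : T1 -> T2 -> R) :
  measurable_fun setT (fun p : T1 * T2 => f p.1 p.2) ->
  measurable_fun setT (fun x => Rintegral m2 setT (f x)).
Proof.
move=> mf; apply: (measurableT_comp (fine_measurable measurableT)).
apply: (@measurable_integral_param m2 (fun x y => (f x y)%:E)).
exact/measurable_EFinP.
Qed.

Lemma cmeas_Cint_param (m2 : {sigma_finite_measure set T2 -> \bar R}) (f : T1 -> T2 -> C) :
  cmeas (fun p : T1 * T2 => f p.1 p.2) -> cmeas (fun x => Cint m2 (f x)).
Proof.
move=> [rf jf]; split => /=.
  exact: (@measurable_Rintegral_param m2 (fun x y => complex.Re (f x y))).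
exact: (@measurable_Rintegral_param m2 (fun x y => complex.Im (f x y))).
Qed.

Variables (m1 : {sigma_finite_measure set T1 -> \bar R})
  (m2 : {sigma_finite_measure set T2 -> \bar R}).

(** Fubini with the inner integral replaced by a candidate [g], constrained only at almost every
    parameter and only if the slice is integrable there. The candidate will be an iterated integral
    in [rintC_Cint] and a Fourier integral with a phase pulled out in [bessel_vec]. *)
Lemma ae_eq_Rintegral_param (f : T1 * T2 -> R) (g : T1 -> R) :
  (prodm m1 m2).-integrable setT (EFin \o f) ->
  measurable_fun setT g ->
  {ae m1, forall x, m2.-integrable setT (fun y => (f (x, y))%:E) ->
    g x = Rintegral m2 setT (fun y => f (x, y))} ->
  m1.-integrable setT (EFin \o g) /\ Rintegral (prodm m1 m2) setT f = Rintegral m1 setT g.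
Proof.
move=> fi mg gf.
have aef := ae_integrable1 fi.
have fF := integrable_fubini_F fi.
have aeg : ae_eq m1 setT (fubini_F m2 (EFin \o f)) (EFin \o g).
  apply: filterS2 aef gf => x fx gx _ /=.
  by rewrite gx// /Rintegral fineK//; exact: integrable_fin_num.
have ig : m1.-integrable setT (EFin \o g).
  move/integrableP : (fF) => [mF iF]; apply/integrableP; split; first exact/measurable_EFinP.
  apply: le_lt_trans iF; rewrite le_eqVlt; apply/orP; left; apply/eqP.
  apply: ae_eq_integral => //.
  - by apply: measurableT_comp => //; exact/measurable_EFinP.
  - exact: measurableT_comp.
  - by apply: filterS aeg => x + _ => /(_ I) /= ->.
split=> //; congr fine; rewrite -[LHS](integral12_prod_meas1 fi).
apply: ae_eq_integral => //; first exact: (measurable_int m1).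
exact/measurable_EFinP.
Qed.

Lemma ae_eq_Cint_param (f : T1 * T2 -> C) (g : T1 -> C) :
  Cintegrable (prodm m1 m2) f -> cmeas g ->
  (forall x, Cintegrable m2 (fun y => f (x, y)) -> g x = Cint m2 (fun y => f (x, y))) ->
  Cintegrable m1 g /\ Cint (prodm m1 m2) f = Cint m1 g.
Proof.
move=> [rf jf] [rg jg] gf.
have aeR := ae_integrable1 rf; have aeJ := ae_integrable1 jf.
have [] := @ae_eq_Rintegral_param (fun p => complex.Re (f p)) (fun x => complex.Re (g x)) rf rg.
  by apply: filterS aeJ => x jx rx; rewrite gf.
move=> rgi rE.
have [] := @ae_eq_Rintegral_param (fun p => complex.Im (f p)) (fun x => complex.Im (g x)) jf jg.
  by apply: filterS aeR => x rx jx; rewrite gf.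
move=> jgi jE; split; first by split.
by rewrite /Cint rE jE.
Qed.

Lemma Cint_fubini (f : T1 * T2 -> C) : Cintegrable (prodm m1 m2) f ->
  Cintegrable m1 (fun x => Cint m2 (fun y => f (x, y))) /\
  Cint (prodm m1 m2) f = Cint m1 (fun x => Cint m2 (fun y => f (x, y))).
Proof.
move=> fi; apply: ae_eq_Cint_param => //.
apply: cmeas_Cint_param.
have [rf jf] := Cintegrable_cmeas fi.
split; [apply: eq_measurable_fun rf|apply: eq_measurable_fun jf]; by move=> -[].
Qed.

End Parametric.

Section Transport.
Context (R : realType) d1 d2 (X : measurableType d1) (Y : measurableType d2).
Variables (mX : {measure set X -> \bar R}) (mY : {measure set Y -> \bar R}).
Variables (phi : X -> Y) (k : R).
Hypotheses (mphi : measurable_fun setT phi) (k0 : 0 < k).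
Hypothesis phiE : forall F : Y -> \bar R, measurable_fun setT F -> (forall y, 0 <= F y)%E ->
  (\int[mY]_y F y = k%:E * \int[mX]_x F (phi x))%E.

(** A change of variables known for nonnegative integrands extends to signed ones through positive
    and negative parts; integrability makes their difference meaningful. It is applied to [consv]
    with factor 1 and to affine maps with factor [|c| ^+ d]. *)
Lemma Rintegral_transport (h : Y -> R) : mY.-integrable setT (EFin \o h) ->
  mX.-integrable setT (EFin \o (h \o phi)) /\
  Rintegral mY setT h = k * Rintegral mX setT (h \o phi).
Proof.
move=> hi; have /integrableP[mh nh] := hi.
have mh' : measurable_fun setT (EFin \o (h \o phi)) by exact: measurableT_comp mh mphi.
have hphi : mX.-integrable setT (EFin \o (h \o phi)).
  apply/integrableP; split => //.
  move: nh; rewrite phiE//; last exact: measurableT_comp.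
  (* Writing +oo as k times +oo allows the positive factor k to be cancelled. *)
  by rewrite -[X in (_ < X)%E -> _](gt0_muley (x := k%:E))// lte_pmul2l.
split=> //.
set p := (\int[mX]_x (EFin \o (h \o phi))^\+%E x)%E.
set q := (\int[mX]_x (EFin \o (h \o phi))^\-%E x)%E.
have pf : p \is a fin_num := integrable_pos_fin_num measurableT hphi.
have nf : q \is a fin_num := integrable_neg_fin_num measurableT hphi.
have -> : Rintegral mX setT (h \o phi) = fine (p - q) by rewrite /Rintegral integralE.
rewrite /Rintegral integralE phiE//; last exact: (measurable_funepos mh).
rewrite phiE//; last exact: (measurable_funeneg mh).
have -> : (\int[mX]_x (EFin \o h)^\+ (phi x))%E = p.
  by apply: eq_integral => x _; rewrite !funeposE.
have -> : (\int[mX]_x (EFin \o h)^\- (phi x))%E = q.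
  by apply: eq_integral => x _; rewrite !funenegE.
by rewrite -(fineK pf) -(fineK nf) -!EFinM -!EFinB /= mulrBr.
Qed.

Lemma Cint_transport (f : Y -> R[i]) : Cintegrable mY f ->
  Cintegrable mX (fun x => f (phi x)) /\
  Cint mY f = RtoC k * Cint mX (fun x => f (phi x)).
Proof.
move=> [rf jf].
have [ri rE] := @Rintegral_transport (fun y => complex.Re (f y)) rf.
have [ji jE] := @Rintegral_transport (fun y => complex.Im (f y)) jf.
split; first by split.
by apply: complex_eqP; rewrite ?cReM ?cImM /= ?rE ?jE /=; ring.
Qed.

Lemma sqint_transport (f : Y -> R[i]) : cmeas f ->
  sqint mY f = (k%:E * sqint mX (fun x => f (phi x)))%E.
Proof.
move=> mf; rewrite /sqint phiE//; last by move=> y; rewrite lee_fin cabs2_ge0.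
exact/measurable_EFinP/measurable_cabs2.
Qed.

Lemma Lsq_transport (f : Y -> R[i]) : Lsq mY f -> Lsq mX (fun x => f (phi x)).
Proof.
move=> [mf nf]; split; first exact: cmeas_comp mf mphi.
move: nf; rewrite sqint_transport//.
by rewrite -[X in (_ < X)%E -> _](gt0_muley (x := k%:E))// lte_pmul2l.
Qed.

End Transport.

Section IteratedIntegrals.
Context (R : realType).
Local Notation C := R[i].
Local Notation leb := (@lebesgue_measure R).

Lemma vec_of_seq0 (s : seq R) : vec_of_seq 0 s = 0.
Proof. by apply/rowP => -[]. Qed.

Lemma iintE_vol d (F : 'rV[R]_d -> \bar R) : measurable_fun setT F ->
  (forall v, 0 <= F v)%E ->
  iintE d (fun s => F (vec_of_seq d s)) = (\int[vol R d]_v F v)%E.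
Proof.
elim: d F => [|d IH] F mF F0; first by rewrite ge0_integral_vol0//= vec_of_seq0.
rewrite ge0_integral_volS//=; apply: eq_integral => x _.
rewrite -(IH (fun v => F (consv (x, v)))) ?/=.
- by congr iintE; apply/funext => s; rewrite vec_of_seq_cons.
- apply: (@measurable_curry1 _ _ _ _ _ (fun x v => F (consv (x, v)))).
  by apply: measurableT_comp mF _; under eq_fun do rewrite -surjective_pairing; exact: measurable_consv.
- by move=> v; exact: F0.
Qed.

Lemma rmeasE d (f : 'rV[R]_d -> C) : rmeas f <-> cmeas f.
Proof.
split=> -[rf jf]; split.
- by apply/measurable_fun_rowE; exact: rf.
- by apply/measurable_fun_rowE; exact: jf.
- by move/measurable_fun_rowE : rf; exact.
- by move/measurable_fun_rowE : jf; exact.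
Qed.

Lemma norm2E d (f : 'rV[R]_d -> C) : cmeas f -> norm2 f = sqint (vol R d) f.
Proof.
move=> mf; rewrite /norm2 (@iintE_vol d (fun v => (cabs2 (f v))%:E))//.
  exact/measurable_EFinP/measurable_cabs2.
by move=> v; rewrite lee_fin cabs2_ge0.
Qed.

Lemma L2E d (f : 'rV[R]_d -> C) : L2 f <-> Lsq (vol R d) f.
Proof.
split=> [[/rmeasE mf nf]|[mf nf]]; first by split; rewrite // -norm2E.
by split; [exact/rmeasE|rewrite norm2E].
Qed.

Lemma rintC0 (f : 'rV[R]_0 -> C) : rintC f = f 0.
Proof. by rewrite /rintC /= vec_of_seq0. Qed.

Lemma rintCS d (f : 'rV[R]_d.+1 -> C) :
  rintC f = Cint leb (fun x => rintC (fun v => f (consv (x, v)))).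
Proof.
rewrite /rintC /= /cint /Cint; congr Complex; congr Rintegral; apply/funext => x;
  congr (_ (iintC _ _)); apply/funext => s; by rewrite vec_of_seq_cons.
Qed.

(* At parameters where a section is not integrable the iterated integral has a
   junk value; measurability is needed there too, as the library's integrals of
   almost everywhere equal functions agree only when both are measurable. *)
Lemma cmeas_rintC_param d dT (T : measurableType dT) (f : T -> 'rV[R]_d -> C) :
  cmeas (fun p : T * 'rV[R]_d => f p.1 p.2) -> cmeas (fun t => rintC (f t)).
Proof.
elim: d dT T f => [|d IH] dT T f mf.
  under eq_fun do rewrite rintC0.
  apply: (cmeas_comp mf (g := fun t : T => (t, 0 : 'rV[R]_0))).
  by apply: measurable_fun_pair.
under eq_fun do rewrite rintCS.
apply: (@cmeas_Cint_param _ _ _ _ _ leb (fun t x => rintC (fun v => f t (consv (x, v))))).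
apply: (IH _ _ (fun (q : T * measurableTypeR R) v => f q.1 (consv (q.2, v)))).
apply: (cmeas_comp mf (g := fun q : (T * measurableTypeR R) * 'rV[R]_d =>
  (q.1.1, consv (q.1.2, q.2)))).
apply: measurable_fun_pair; first exact: measurableT_comp measurable_fst measurable_fst.
apply: measurableT_comp (@measurable_consv R d) _.
by apply: measurable_fun_pair => //; exact: measurableT_comp measurable_snd measurable_fst.
Qed.

(** The factor [1%:E] gives the equation the shape of the hypothesis [phiE] of the transport
    lemmas. *)
Lemma ge0_integral_consv d (F : 'rV[R]_d.+1 -> \bar R) :
  measurable_fun setT F -> (forall v, 0 <= F v)%E ->
  (\int[vol R d.+1]_v F v = 1%:E * \int[prodm leb (vol R d)]_p F (consv p))%E.
Proof.
move=> mF F0; rewrite mul1e.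
transitivity (\int[pushforward (prodm leb (vol R d)) (@consv R d)]_v F v)%E; first by [].
by rewrite (ge0_integral_pushforward (@measurable_consv R d) _ measurableT mF).
Qed.

(** Integrability of [f] makes almost every slice in the first coordinate integrable; the induction
    hypothesis applies to those, and [ae_eq_Cint_param] absorbs the default values at the others. *)
Lemma rintC_Cint d (f : 'rV[R]_d -> C) : Cintegrable (vol R d) f -> rintC f = Cint (vol R d) f.
Proof.
elim: d f => [|d IH] f fi.
  rewrite rintC0; have [rf jf] := Cintegrable_cmeas fi.
  by apply: complex_eqP; rewrite /= /Rintegral integral_dirac ?diracT ?mul1e//; exact/measurable_EFinP.
have [fc ->] := Cint_transport (@measurable_consv R d) ltr01 (@ge0_integral_consv d) fi.
rewrite RtoC1 mul1r rintCS.
have [] // := @ae_eq_Cint_param _ _ _ _ _ leb (vol R d) (fun p => f (consv p))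
  (fun x => rintC (fun v => f (consv (x, v)))) fc.
  apply: (@cmeas_rintC_param d _ _ (fun x v => f (consv (x, v)))).
  have := Cintegrable_cmeas fc; rewrite /cmeas => -[r j].
  by split; [apply: eq_measurable_fun r|apply: eq_measurable_fun j] => -[].
by move=> x fx; exact: IH.
Qed.

Lemma row_mx_consv n m (x : R) (u : 'rV[R]_n) (v : 'rV[R]_m) :
  row_mx (consv (x, u)) v = consv (x, row_mx u v) :> 'rV[R]_(n.+1 + m).
Proof.
apply/rowP => i; case: (split_ordP i) => j ->.
  rewrite row_mxEl; case: (unliftP ord0 j) => [l|] ->.
    rewrite consvS (_ : lshift m (lift ord0 l) = lift ord0 (lshift m l)); last exact: val_inj.
    by rewrite consvS row_mxEl.
  rewrite consv0 (_ : lshift m ord0 = ord0); last exact: val_inj.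
  by rewrite consv0.
rewrite row_mxEr (_ : rshift n.+1 j = lift ord0 (rshift n j)); last exact: val_inj.
by rewrite consvS row_mxEr.
Qed.

Lemma row_mx0l m (u : 'rV[R]_0) (v : 'rV[R]_m) : row_mx u v = v :> 'rV[R]_(0 + m).
Proof.
apply/rowP => i; case: (split_ordP i) => -[j jm] ->; first by [].
by rewrite row_mxEr; congr (v _ _); exact: val_inj.
Qed.

Lemma ge0_integral_vol_split n m (F : 'rV[R]_(n + m) -> \bar R) :
  measurable_fun setT F -> (forall v, 0 <= F v)%E ->
  (\int[vol R (n + m)]_z F z = \int[vol R n]_u \int[vol R m]_v F (row_mx u v))%E.
Proof.
elim: n F => [|n IH] F mF F0.
  rewrite ge0_integral_vol0.
    by apply: eq_integral => v _; rewrite row_mx0l.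
  apply: (@measurable_ge0_integral _ _ _ _ _ (vol R m) (fun u v => F (row_mx u v))) => //.
  by apply: measurableT_comp mF _; exact: measurable_row_mx.
have mI : measurable_fun setT (fun u : 'rV[R]_n.+1 => \int[vol R m]_v F (row_mx u v))%E.
  apply: (@measurable_ge0_integral _ _ _ _ _ (vol R m) (fun u v => F (row_mx u v))) => //.
  by apply: measurableT_comp mF _; exact: measurable_row_mx.
rewrite (ge0_integral_volS mI); last by move=> u; apply: integral_ge0 => v _; exact: F0.
(* The dimensions [n.+1 + m] and [(n + m).+1] are convertible, so retyping [F] suffices to peel off
   its first coordinate. *)
have mF' : measurable_fun setT (F : 'rV[R]_(n + m).+1 -> \bar R) by exact: mF.
rewrite [LHS](ge0_integral_volS mF')//.
apply: eq_integral => x _; rewrite (IH (fun w => F (consv (x, w)))).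
- apply: eq_integral => u _; apply: eq_integral => v _.
  by rewrite row_mx_consv.
- apply: (@measurable_curry1 _ _ _ _ _ (fun x v => F (consv (x, v)))).
  by apply: measurableT_comp mF _; under eq_fun do rewrite -surjective_pairing; exact: measurable_consv.
- by move=> w; exact: F0.
Qed.

Lemma measurable_affinev d (c : R) (b : 'rV[R]_d) :
  measurable_fun setT (fun v : 'rV[R]_d => c *: v + b).
Proof. by apply: measurable_addv => //; exact: measurable_scalev. Qed.

Lemma Cint_vol_affine d (c : R) (b : 'rV[R]_d) (f : 'rV[R]_d -> C) : c != 0 ->
  Cintegrable (vol R d) f ->
  Cintegrable (vol R d) (fun v => f (c *: v + b)) /\
  Cint (vol R d) f = RtoC (`|c| ^+ d) * Cint (vol R d) (fun v => f (c *: v + b)).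
Proof.
move=> c0; apply: Cint_transport; first exact: measurable_affinev.
  by rewrite exprn_gt0// normr_gt0.
by move=> F mF F0; exact: ge0_integral_vol_affine.
Qed.

Lemma Lsq_vol_affine d (c : R) (b : 'rV[R]_d) (f : 'rV[R]_d -> C) : c != 0 ->
  Lsq (vol R d) f -> Lsq (vol R d) (fun v => f (c *: v + b)).
Proof.
move=> c0; apply: (@Lsq_transport _ _ _ _ _ _ _ _ (`|c| ^+ d)); first exact: measurable_affinev.
  by rewrite exprn_gt0// normr_gt0.
by move=> F mF F0; exact: ge0_integral_vol_affine.
Qed.

Lemma sqint_vol_affine d (c : R) (b : 'rV[R]_d) (f : 'rV[R]_d -> C) : c != 0 -> cmeas f ->
  sqint (vol R d) f = ((`|c| ^+ d)%:E * sqint (vol R d) (fun v => f (c *: v + b)%R))%E.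
Proof.
move=> c0; apply: sqint_transport.
by move=> F mF F0; exact: ge0_integral_vol_affine.
Qed.

End IteratedIntegrals.

(** * The Bessel inequality for the Fourier transform *)

Section AbelKernel.
Context (R : realType).
Local Notation leb := (@lebesgue_measure R).
Variables (e : R) (e0 : 0 < e).

Definition abelw (p : R) : R := expR (- (e * `|p|)).

Lemma abelw_ge0 p : 0 <= abelw p. Proof. exact: expR_ge0. Qed.

Lemma continuous_abelw : continuous abelw.
Proof.
move=> x; apply: (@continuous_comp _ _ _ (fun p => - (e * `|p|)) expR).
  apply: cvgN; apply: cvgM; first exact: cvg_cst.
  exact: norm_continuous.
exact: continuous_expR.
Qed.

Lemma measurable_abelw : measurable_fun setT abelw.
Proof. exact: continuous_measurable_fun continuous_abelw. Qed.

Let D (u : R) : R := e ^+ 2 + u ^+ 2.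
Let D0 u : 0 < D u. Proof. by rewrite ltr_wpDr ?sqr_ge0// exprn_gt0. Qed.

(** An antiderivative of exp (- e p) (1 + cos (u p)) that vanishes at +oo. The summand 1 keeps the
    integrand nonnegative, as the fundamental theorem on a half-line requires here; the cosine
    transform follows by subtracting the integral of the weight alone. *)
Let G (u p : R) : R :=
  expR (- e * p) * (- e^-1 + (u * sin (u * p) - e * cos (u * p)) / D u).

Let G_derive (u p : R) : is_derive p (1 : R) (G u)
  (expR (- e * p) * (1 + cos (u * p))).
Proof.
rewrite /G.
apply: is_derive_eq.
rewrite /GRing.scale /= /D.
by field; rewrite !gt_eqF//; exact: D0.
Qed.

Let G_cvg u : G u x @[x --> +oo] --> 0.
Proof.
have E0 : expR (- e * x) @[x --> +oo] --> (0 : R).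
  have -> : (fun x => expR (- e * x)) = (fun x => expR (- x)) \o (fun x => e * x).
    by apply/funext => x /=; rewrite mulNr.
  apply: (@cvg_comp _ _ _ _ _ _ (pinfty_nbhs R)); last exact: cvgr_expR.
  exact: gt0_cvgMry.
pose M := e^-1 + (`|u| + e) / D u.
have M0 x : `| - e^-1 + (u * sin (u * x) - e * cos (u * x)) / D u| <= M.
  rewrite (le_trans (ler_normD _ _))// normrN (gtr0_norm (x := e^-1)) ?invr_gt0// lerD2l.
  rewrite normrM (gtr0_norm (x := (D u)^-1)) ?invr_gt0// ler_pM2r ?invr_gt0//.
  rewrite (le_trans (ler_normB _ _))// !normrM (gtr0_norm e0) lerD//.
    rewrite ler_piMr// ler_norml; apply/andP; split; [exact: sin_geN1|exact: sin_le1].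
  rewrite ler_piMr ?(ltW e0)// ler_norml; apply/andP; split; [exact: cos_geN1|exact: cos_le1].
have EM0 : expR (- e * x) * M @[x --> +oo] --> 0.
  by rewrite -(mul0r M); apply: cvgM E0 _; exact: cvg_cst.
apply: (@squeeze_cvgr _ _ _ _ (fun x => - (expR (- e * x) * M)) (fun x => expR (- e * x) * M)).
- apply: nearW => x; rewrite -ler_norml /G normrM (gtr0_norm (expR_gt0 _)).
  by rewrite ler_pM2l ?expR_gt0.
- by rewrite -oppr0; apply: cvgN.
- exact: EM0.
Qed.

Lemma integral_abelw_1cos u :
  (\int[leb]_p (abelw p * (1 + cos (u * p)))%:E = (2 / e + 2 * e / (e ^+ 2 + u ^+ 2))%:E)%E.
Proof.
have cf : continuous (fun p => abelw p * (1 + cos (u * p))).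
  move=> x; apply: cvgM; first exact: continuous_abelw.
  apply: cvgD; first exact: cvg_cst.
  apply: (@continuous_comp _ _ _ (fun p => u * p) cos); last exact: continuous_cos.
  by apply: cvgM; [exact: cvg_cst|exact: cvg_id].
have c0 p : 0 <= 1 + cos (u * p) by have := cos_geN1 (u * p); lra.
rewrite ge0_symfun_integralT//; first last.
- by move=> p /=; rewrite /abelw normrN mulrN cosN.
- by move=> p; rewrite mulr_ge0// abelw_ge0.
have -> : [set x : R | 0 <= x] = `[0, +oo[%classic.
  by apply/seteqP; split => x /=; rewrite in_itv /= andbT.
have -> : (\int[leb]_(x in `[0%R, +oo[) (abelw x * (1 + cos (u * x)))%:E =
   \int[leb]_(x in `[0%R, +oo[) (expR (- e * x) * (1 + cos (u * x)))%:E)%E.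
  apply: eq_integral => x; rewrite inE/= in_itv/= andbT => x0.
  by rewrite /abelw ger0_norm// mulNr.
rewrite (@ge0_continuous_FTC2y _ _ (G u) 0 0); first last.
- by move=> x _; have gd := G_derive u x; rewrite derive1E derive_val.
- have gd := G_derive u 0; apply: cvg_at_right_filter.
  by apply: differentiable_continuous; apply/derivable1_diffP; exact: ex_derive.
- by move=> x _; have gd := G_derive u x; exact: ex_derive.
- exact: G_cvg.
- apply: continuous_subspaceT => x; apply: cvgM.
    apply: (@continuous_comp _ _ _ (fun p => - e * p) expR); last exact: continuous_expR.
    by apply: cvgM; [exact: cvg_cst|exact: cvg_id].
  apply: cvgD; first exact: cvg_cst.
  apply: (@continuous_comp _ _ _ (fun p => u * p) cos); last exact: continuous_cos.
  by apply: cvgM; [exact: cvg_cst|exact: cvg_id].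
- by move=> x _; rewrite mulr_ge0// expR_ge0.
rewrite -EFinB -EFinM /G !mulr0 expR0 sin0 cos0 /D; congr EFin.
by field; rewrite !gt_eqF//; exact: D0.
Qed.

Lemma integral_abelw : (\int[leb]_p (abelw p)%:E = (2 / e)%:E)%E.
Proof.
have := integral_abelw_1cos 0.
under eq_integral do rewrite mul0r cos0 mulrC.
rewrite ge0_integralRZ//; last 2 first.
- exact: abelw_ge0.
- exact: measurable_abelw.
move=> h; have : ((2^-1)%:E * ((1 + 1)%R%:E * \int[leb]_p (abelw p)%:E) = (2^-1)%:E * (2 / e + 2 * e / (e ^+ 2 + 0 ^+ 2))%:E)%E.
  by rewrite h.
rewrite muleA -!EFinM (_ : 2^-1 * (1 + 1) = 1) ?mul1e; last by field.
by move=> ->; congr EFin; field; rewrite gt_eqF.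
Qed.

Lemma integrable_abelw : leb.-integrable setT (EFin \o abelw).
Proof.
apply/integrableP; split; first by apply/measurable_EFinP; exact: measurable_abelw.
under eq_integral do rewrite /= ger0_norm ?abelw_ge0//.
by rewrite integral_abelw ltry.
Qed.

Lemma measurable_cosM (u : R) : measurable_fun setT (fun p : R => cos (u * p)).
Proof.
apply: (measurableT_comp (continuous_measurable_fun (@continuous_cos R))).
exact: measurable_funM.
Qed.

Lemma Rintegral_abelw_cos u :
  Rintegral leb setT (fun p => abelw p * cos (u * p)) = 2 * e / (e ^+ 2 + u ^+ 2).
Proof.
have i1 : leb.-integrable setT (fun p : R => (abelw p * (1 + cos (u * p)))%:E).
  apply/integrableP; split.
    apply/measurable_EFinP; apply: measurable_funM; first exact: measurable_abelw.
    by apply: measurable_funD => //; exact: measurable_cosM.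
  have c0 p : 0 <= 1 + cos (u * p) by have := cos_geN1 (u * p); lra.
  under eq_integral do rewrite /= ger0_norm ?mulr_ge0 ?abelw_ge0//.
  by rewrite integral_abelw_1cos ltry.
have -> : (fun p => abelw p * cos (u * p)) = fun p => abelw p * (1 + cos (u * p)) - abelw p.
  by apply/funext => p; ring.
rewrite RintegralB//; last exact: integrable_abelw.
by rewrite /Rintegral integral_abelw_1cos integral_abelw /=; ring.
Qed.

(** The substitution u = (e / s) x reduces this to the integral of 1 / (1 + x^2), and e cancels.
    That cancellation makes the later bound uniform in e. *)
Lemma integral_cauchy (s : R) : s != 0 ->
  (\int[leb]_u (2 * e / (e ^+ 2 + (s * u) ^+ 2))%:E = (2 * pi / `|s|)%:E)%E.
Proof.
move=> s0.
have es0 : e / s != 0 by rewrite mulf_neq0 ?invr_eq0// gt_eqF.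
have mk : measurable_fun setT (fun u : R => (2 * e / (e ^+ 2 + (s * u) ^+ 2))%:E).
  apply/measurable_EFinP; apply: continuous_measurable_fun => x.
  apply: cvgM; first exact: cvg_cst.
  apply: cvgV; first by rewrite gt_eqF//; exact: (D0 (s * x)).
  apply: cvgD; first exact: cvg_cst.
  apply: (@continuous_comp _ _ _ (fun u => s * u) (fun u => u ^+ 2)); last exact: exprn_continuous.
  by apply: cvgM; [exact: cvg_cst|exact: cvg_id].
rewrite (ge0_integral_affine1 0 es0)//; last first.
  move=> u; rewrite lee_fin; apply: divr_ge0; last exact: ltW (D0 (s * u)).
  by rewrite mulr_ge0// ltW.
transitivity (`|e / s|%:E * \int[leb]_x ((2 / e) * (oneDsqr x)^-1)%:E)%E.
  congr (_ * _)%E; apply: eq_integral => x _; congr EFin.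
  rewrite (_ : s * (e / s * x + 0) = e * x); last by field.
  have x1 : 1 + x ^+ 2 != 0 by rewrite gt_eqF// ltr_wpDr ?sqr_ge0.
  have x2 : e ^+ 2 + (e * x) ^+ 2 != 0 by rewrite gt_eqF//; exact: (D0 (e * x)).
  by rewrite /oneDsqr; field; rewrite x1 x2 gt_eqF.
have V0 (x : R) : 0 <= (oneDsqr x)^-1 by rewrite invr_ge0 ltW// oneDsqr_gt0.
have mV : measurable_fun setT (fun x : measurableTypeR R => (oneDsqr (x : R))^-1).
  exact: continuous_measurable_fun (@continuous_oneDsqrV R).
have e2 : 0 <= 2 / e by rewrite divr_ge0// ltW.
have -> := ge0_integralRZ leb e2 V0 mV.
have eV : (fun x : R => (oneDsqr x)^-1) =1 (fun x => (oneDsqr x)^-1) \o -%R.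
  by move=> x /=; rewrite /oneDsqr sqrrN.
rewrite (ge0_symfun_integralT V0 (@continuous_oneDsqrV R) eV).
have -> : [set x : R | 0 <= x] = `[0, +oo[%classic.
  by apply/seteqP; split => x /=; rewrite in_itv /= andbT.
rewrite integral0y_oneDsqr -!EFinM normrM (gtr0_norm e0) normfV; congr EFin.
by field; rewrite normr_eq0 s0 gt_eqF.
Qed.

End AbelKernel.

(** * Cosine and sine transforms of a real function *)

Section BesselReal.
Context (R : realType).
Local Notation leb := (@lebesgue_measure R).
Local Notation RL := (measurableTypeR R).
Variables (s : R) (s0 : s != 0).
Variable h : RL -> R.
Hypothesis mh : measurable_fun setT h.
Hypothesis ih : leb.-integrable setT (EFin \o h).

Let c p := Rintegral leb setT (fun y : RL => h y * cos (s * p * y)).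
Let d p := Rintegral leb setT (fun y : RL => h y * sin (s * p * y)).

Let mcos (t : R) : measurable_fun setT (fun y : RL => cos (t * y) : R).
Proof.
apply: (measurableT_comp (continuous_measurable_fun (@continuous_cos R))).
exact: measurable_funM.
Qed.

Let msin (t : R) : measurable_fun setT (fun y : RL => sin (t * y) : R).
Proof.
apply: (measurableT_comp (continuous_measurable_fun (@continuous_sin R))).
exact: measurable_funM.
Qed.

Let cos1 (x : R) : `|cos x| <= 1.
Proof. by rewrite ler_norml cos_geN1 cos_le1. Qed.

Let sin1 (x : R) : `|sin x| <= 1.
Proof. by rewrite ler_norml sin_geN1 sin_le1. Qed.

Let ibound (g : RL -> R) : measurable_fun setT g -> (forall y, `|g y| <= 1) ->
  leb.-integrable setT (fun y => (h y * g y)%:E).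
Proof.
move=> mg g1; apply: le_integrable ih => //.
  by apply/measurable_EFinP; exact: measurable_funM.
by move=> y _ /=; rewrite lee_fin normrM ler_piMr.
Qed.

Let nhfin : (\int[leb]_y `|h y|%:E < +oo)%E.
Proof. by move/integrableP : ih => []. Qed.

Let mh1 : measurable_fun setT (fun q : RL * RL => h q.1).
Proof. exact: measurableT_comp mh measurable_fst. Qed.
Let mh2 : measurable_fun setT (fun q : RL * RL => h q.2).
Proof. exact: measurableT_comp mh measurable_snd. Qed.

Let iprod : (\int[prodm leb leb]_q (`|h q.1| * `|h q.2|)%:E < +oo)%E.
Proof.
have m12 : measurable_fun setT (fun q : RL * RL => (`|h q.1| * `|h q.2|)%:E).
  by apply/measurable_EFinP; apply: measurable_funM; exact: measurableT_comp.
rewrite /prodm fubini_tonelli1//.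
rewrite /fubini_F /=.
under eq_integral.
  move=> y _; rewrite ge0_integralRZ//; last exact: measurableT_comp.
  over.
rewrite -(@fineK _ (\int[leb]_y `|h y|%:E)%E); last by rewrite ge0_fin_numE// ge0_integralR_ge0.
under eq_integral do rewrite muleC -EFinM.
rewrite ge0_integralRZ//.
- by rewrite lte_mul_pinfty// lee_fin fine_ge0// ge0_integralR_ge0.
- by rewrite fine_ge0// ge0_integralR_ge0.
- exact: measurableT_comp.
Qed.

Let mcos2 (p : R) : measurable_fun setT (fun q : RL * RL => cos (s * p * (q.1 - q.2)) : R).
Proof.
apply: (measurableT_comp (continuous_measurable_fun (@continuous_cos R))).
apply: measurable_funM => //; exact: measurable_funB.
Qed.

Let F2 (p : R) (q : RL * RL) : R := h q.1 * h q.2 * cos (s * p * (q.1 - q.2)).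

Let F2_integrable p : (prodm leb leb).-integrable setT (EFin \o F2 p).
Proof.
apply/integrableP; split.
  by apply/measurable_EFinP; apply: measurable_funM => //; exact: measurable_funM.
apply: le_lt_trans iprod; apply: ge0_le_integralR => //.
- by move=> q; rewrite /F2 !normrM ler_piMr// mulr_ge0.
- apply: measurableT_comp => //; apply: measurable_funM => //; exact: measurable_funM.
- by apply: measurable_funM; exact: measurableT_comp.
Qed.

(** The addition formula for cos (s p (y - z)) separates the variables, and the double integral
    becomes the sum of two products. In this form the frequency [p] sits in a single cosine, which
    can be integrated against the weight. *)
Lemma Rintegral_sqr_fourier p : Rintegral (prodm leb leb) setT (F2 p) = c p ^+ 2 + d p ^+ 2.
Proof.
have ic := ibound (mcos (s * p)) (fun y => cos1 _).
have js := ibound (msin (s * p)) (fun y => sin1 _).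
pose g (y : RL) := c p * (h y * cos (s * p * y)) + d p * (h y * sin (s * p * y)).
have mg : measurable_fun setT g.
  by apply: measurable_funD; apply: measurable_funM => //; apply: measurable_funM.
have [] := @ae_eq_Rintegral_param _ _ _ _ _ leb leb (F2 p) g (F2_integrable p) mg.
  apply: aeW => y _; rewrite /F2 /=.
  have -> : (fun y0 : RL => h y * h y0 * cos (s * p * (y - y0))) =
     (fun y0 => (h y * cos (s * p * y)) * (h y0 * cos (s * p * y0)) +
                (h y * sin (s * p * y)) * (h y0 * sin (s * p * y0))).
    by apply/funext => y0; rewrite mulrBr cosB; ring.
  rewrite RintegralD//; try exact: integrable_scaleE.
  by rewrite !RintegralZl// /g /c /d; ring.
move=> _ ->; rewrite /g RintegralD//; try exact: integrable_scaleE.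
by rewrite !RintegralZl// -/(c p) -/(d p); ring.
Qed.

Let kern (e u : R) : R := 2 * e / (e ^+ 2 + (s * u) ^+ 2).

Let kern_ge0 e u : 0 < e -> 0 <= kern e u.
Proof.
move=> e0; apply: divr_ge0; first by rewrite mulr_ge0// ltW.
by rewrite addr_ge0// sqr_ge0.
Qed.

Let mkern e : 0 < e -> measurable_fun setT (kern e : RL -> R).
Proof.
move=> e0; apply: continuous_measurable_fun => x.
apply: cvgM; first exact: cvg_cst.
apply: cvgV; first by rewrite gt_eqF// ltr_wpDr ?sqr_ge0// exprn_gt0.
apply: cvgD; first exact: cvg_cst.
apply: (@continuous_comp _ _ _ (fun u => s * u) (fun u => u ^+ 2)); last exact: exprn_continuous.
by apply: cvgM; [exact: cvg_cst|exact: cvg_id].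
Qed.

Let kernB e y : 0 < e -> (\int[leb]_z (kern e (y - z))%:E = (2 * pi / `|s|)%:E)%E.
Proof.
move=> e0; rewrite -(integral_cauchy e0 s0).
have N1 : -1 != 0 :> R by rewrite oppr_eq0 oner_eq0.
have mk : measurable_fun setT (fun u => (kern e u)%:E) by apply/measurable_EFinP; exact: mkern.
rewrite [RHS](ge0_integral_affine1 y N1 mk); last by move=> u; rewrite lee_fin kern_ge0.
rewrite normrN normr1 mul1e; apply: eq_integral => z _.
by rewrite mulN1r addrC.
Qed.

Let mkern2 e : 0 < e -> measurable_fun setT (fun q : RL * RL => kern e (q.1 - q.2)).
Proof. by move=> e0; apply: measurableT_comp (mkern e0) _; exact: measurable_funB. Qed.

(** Together with [schur2], the two halves of a Schur test: integrating out the variable that [h]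
    does not see leaves the total mass of the kernel. *)
Let schur1 e : 0 < e ->
  (\int[prodm leb leb]_q (h q.1 ^+ 2 * kern e (q.1 - q.2))%:E =
   (2 * pi / `|s|)%:E * \int[leb]_y (h y ^+ 2)%:E)%E.
Proof.
move=> e0.
have m12 : measurable_fun setT (fun q : RL * RL => (h q.1 ^+ 2 * kern e (q.1 - q.2))%:E).
  by apply/measurable_EFinP/measurable_funM; [exact: measurable_funX|exact: mkern2].
rewrite /prodm fubini_tonelli1//; last by move=> q; rewrite lee_fin mulr_ge0 ?sqr_ge0 ?kern_ge0.
rewrite /fubini_F /=.
under eq_integral.
  move=> y _; rewrite ge0_integralRZ ?sqr_ge0//; last 2 first.
  - by move=> z; exact: kern_ge0.
  - apply: (measurableT_comp (mkern e0) (g := fun z : RL => y - z)).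
    exact: measurable_funB.
  rewrite kernB// muleC -EFinM.
  over.
rewrite ge0_integralRZ//; last exact: measurable_funX.
  by rewrite divr_ge0// mulr_ge0// pi_ge0.
by move=> y; exact: sqr_ge0.
Qed.

Let schur2 e : 0 < e ->
  (\int[prodm leb leb]_q (h q.2 ^+ 2 * kern e (q.1 - q.2))%:E =
   (2 * pi / `|s|)%:E * \int[leb]_y (h y ^+ 2)%:E)%E.
Proof.
move=> e0; rewrite -(schur1 e0).
have m12 : measurable_fun setT (fun q : RL * RL => (h q.2 ^+ 2 * kern e (q.1 - q.2))%:E).
  by apply/measurable_EFinP/measurable_funM; [exact: measurable_funX|exact: mkern2].
have m21 : measurable_fun setT (fun q : RL * RL => (h q.1 ^+ 2 * kern e (q.1 - q.2))%:E).
  by apply/measurable_EFinP/measurable_funM; [exact: measurable_funX|exact: mkern2].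
rewrite /prodm (fubini_tonelli1 _ m21); last by move=> q; rewrite lee_fin mulr_ge0 ?sqr_ge0 ?kern_ge0.
rewrite (fubini_tonelli2 _ m12); last by move=> q; rewrite lee_fin mulr_ge0 ?sqr_ge0 ?kern_ge0.
apply: eq_integral => y _; apply: eq_integral => z _ /=.
congr (_ * _)%:E; rewrite /kern; congr (_ / _); congr (_ + _).
by rewrite -opprB mulrN sqrrN.
Qed.

(** Integrating the weight first replaces the oscillating cosine by the positive kernel
    [kern e (y - z)]; a kernel form is then bounded by its mass times the squared norm, by Schur's
    test. *)
Lemma abel_fourier_le e : 0 < e ->
  (\int[leb]_p (abelw e p * (c p ^+ 2 + d p ^+ 2))%:E <=
   (2 * pi / `|s|)%:E * \int[leb]_y (h y ^+ 2)%:E)%E.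
Proof.
move=> e0.
pose Phi (z : RL * (RL * RL)) := (abelw e z.1 * F2 z.1 z.2)%:E.
have mw : measurable_fun setT (abelw e : RL -> R) by exact: measurable_abelw.
have mPhi : measurable_fun setT Phi.
  apply/measurable_EFinP; apply: measurable_funM.
    exact: measurableT_comp mw measurable_fst.
  apply: measurable_funM; first apply: measurable_funM.
  - exact: measurableT_comp mh1 measurable_snd.
  - exact: measurableT_comp mh2 measurable_snd.
  apply: (measurableT_comp (continuous_measurable_fun (@continuous_cos R))).
  apply: measurable_funM; first by apply: measurable_funM.
  apply: measurable_funB.
    exact: measurableT_comp measurable_fst measurable_snd.
  exact: measurableT_comp measurable_snd measurable_snd.
(* The integrand is dominated by the weight in p times |h(y)| |h(z)|, whose integral is finite as
   [h] is integrable. *)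
have iPhi : (prodm leb (prodm leb leb)).-integrable setT Phi.
  apply/integrable12ltyP => //.
  apply: (@le_lt_trans _ _ (\int[leb]_p ((fine (\int[prodm leb leb]_q (`|h q.1| * `|h q.2|)%:E)) * abelw e p)%:E)%E).
    apply: ge0_le_integral => //=.
    - by move=> p _; exact: integral_ge0.
    - apply: (@measurable_ge0_integral _ _ _ _ _ (prodm leb leb) (fun p q => `|Phi (p, q)|%E)) => //.
      by apply: measurableT_comp => //; apply: eq_measurable_fun mPhi => -[].
    - by apply/measurable_EFinP; exact: measurable_funM.
    - move=> p _; rewrite EFinM fineK; last by rewrite ge0_fin_numE// integral_ge0.
      rewrite muleC -ge0_integralRZ ?abelw_ge0//; last first.
        by apply: measurable_funM; exact: measurableT_comp.
      apply: ge0_le_integralR => //.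
      + move=> q; rewrite normrM ger0_norm ?abelw_ge0// ler_wpM2l ?abelw_ge0//.
        by rewrite /F2 !normrM ler_piMr// mulr_ge0.
      + apply: measurableT_comp => //; apply: measurable_funM => //.
        by apply: measurable_funM => //; exact: measurable_funM.
      + by apply: measurable_funM => //; apply: measurable_funM; exact: measurableT_comp.
  rewrite ge0_integralRZ ?integral_abelw ?ltry//.
  - by rewrite fine_ge0// integral_ge0.
  - by move=> p; exact: abelw_ge0.
have pE p : (\int[prodm leb leb]_q Phi (p, q) = (abelw e p * (c p ^+ 2 + d p ^+ 2))%:E)%E.
  rewrite -Rintegral_sqr_fourier -RintegralZl//; last exact: F2_integrable.
  rewrite /Rintegral fineK//; apply: integrable_fin_num => //.
  exact: integrable_scaleE (F2_integrable p).
have qE q : (\int[leb]_p Phi (p, q) = (h q.1 * h q.2 * kern e (q.1 - q.2))%:E)%E.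
  rewrite /Phi /F2 /=.
  have -> : (fun p => (abelw e p * (h q.1 * h q.2 * cos (s * p * (q.1 - q.2))))%:E) =
    (fun p => (h q.1 * h q.2 * (abelw e p * cos (s * (q.1 - q.2) * p)))%:E).
    by apply/funext => p; congr EFin; rewrite [s * p * _]mulrAC; ring.
  have iwc : leb.-integrable setT (fun p : RL => (abelw e p * cos (s * (q.1 - q.2) * p))%:E).
    apply: (le_integrable _ _ _ (integrable_abelw e0)) => //.
      by apply/measurable_EFinP; apply: measurable_funM.
    by move=> p _; rewrite lee_fin normrM ler_piMr.
  have := integrable_scaleE (h q.1 * h q.2) iwc.
  move/(integrable_fin_num measurableT)/fineK => <-.
  by congr EFin; rewrite -[LHS]/(Rintegral leb setT _) RintegralZl// Rintegral_abelw_cos.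
(* The exchange of integrations: [pE] evaluates one order and [qE] the other. *)
have -> : (\int[leb]_p (abelw e p * (c p ^+ 2 + d p ^+ 2))%:E =
    \int[prodm leb leb]_q (h q.1 * h q.2 * kern e (q.1 - q.2))%:E)%E.
  transitivity (\int[leb]_p \int[prodm leb leb]_q Phi (p, q))%E.
    by apply: eq_integral => p _; rewrite pE.
  transitivity (\int[prodm leb leb]_q \int[leb]_p Phi (p, q))%E.
    by rewrite [LHS](integral12_prod_meas1 iPhi) [RHS](integral21_prod_meas1 iPhi).
  by apply: eq_integral => q _; rewrite qE.
apply: (le_trans (lee_abs _)).
have mhk : measurable_fun setT (fun q : RL * RL => h q.1 * h q.2 * kern e (q.1 - q.2)).
  by apply: measurable_funM; [exact: measurable_funM|exact: mkern2].
apply: (le_trans (le_abse_integral _ measurableT _)); first exact/measurable_EFinP.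
(* From |ab| <= (a^2 + b^2) / 2 and positivity of the kernel; each half is then one of the Schur
   integrals. *)
apply: (@le_trans _ _ (\int[prodm leb leb]_q (2^-1 * (h q.1 ^+ 2 * kern e (q.1 - q.2)) +
    2^-1 * (h q.2 ^+ 2 * kern e (q.1 - q.2)))%:E)%E).
  have m1 : measurable_fun setT (fun q : RL * RL => h q.1 ^+ 2 * kern e (q.1 - q.2)).
    by apply: measurable_funM; [exact: measurable_funX|exact: mkern2].
  have m2 : measurable_fun setT (fun q : RL * RL => h q.2 ^+ 2 * kern e (q.1 - q.2)).
    by apply: measurable_funM; [exact: measurable_funX|exact: mkern2].
  apply: ge0_le_integralR => //.
  - move=> q; rewrite normrM normrM (ger0_norm (kern_ge0 _ e0)).
    have k0 := kern_ge0 (q.1 - q.2) e0.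
    rewrite -(real_normK (num_real (h q.1))) -(real_normK (num_real (h q.2))).
    have := mulr_ge0 (sqr_ge0 (`|h q.1| - `|h q.2|)) k0.
    set a := `|h q.1|; set b := `|h q.2|; set k := kern _ _ => ?.
    have -> : 2^-1 * (a ^+ 2 * k) + 2^-1 * (b ^+ 2 * k) = a * b * k + 2^-1 * ((a - b) ^+ 2 * k) by field.
    by rewrite lerDl mulr_ge0.
  - exact: measurableT_comp.
  - by apply: measurable_funD; exact: measurable_funM.
have nn1 (q : RL * RL) : 0 <= h q.1 ^+ 2 * kern e (q.1 - q.2) by rewrite mulr_ge0 ?sqr_ge0 ?kern_ge0.
have nn2 (q : RL * RL) : 0 <= h q.2 ^+ 2 * kern e (q.1 - q.2) by rewrite mulr_ge0 ?sqr_ge0 ?kern_ge0.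
have m1 : measurable_fun setT (fun q : RL * RL => h q.1 ^+ 2 * kern e (q.1 - q.2)).
  by apply: measurable_funM; [exact: measurable_funX|exact: mkern2].
have m2 : measurable_fun setT (fun q : RL * RL => h q.2 ^+ 2 * kern e (q.1 - q.2)).
  by apply: measurable_funM; [exact: measurable_funX|exact: mkern2].
rewrite ge0_integralRD; try (by move=> q; rewrite mulr_ge0 ?nn1 ?nn2); try exact: measurable_funM.
rewrite !ge0_integralRZ// schur1// schur2//.
rewrite -ge0_muleDl ?lee_fin// -EFinD (_ : 2^-1 + 2^-1 = 1) ?mul1e//; by field.
Qed.

(** Along e = 1 / (k + 1) the weights increase to 1, so monotone convergence passes the uniform
    bound to the limit; square integrability of the transform comes out as a conclusion instead of
    being assumed. *)
Lemma bessel_real :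
  (\int[leb]_p (c p ^+ 2 + d p ^+ 2)%:E <=
   (2 * pi / `|s|)%:E * \int[leb]_y (h y ^+ 2)%:E)%E.
Proof.
have mg : measurable_fun setT (fun p : RL => c p ^+ 2 + d p ^+ 2).
  apply: measurable_funD; apply: measurable_funX.
    apply: (@measurable_Rintegral_param _ _ _ _ _ leb (fun p y : RL => h y * cos (s * p * y))).
    apply: measurable_funM => //.
    apply: (measurableT_comp (continuous_measurable_fun (@continuous_cos R))).
    by apply: measurable_funM => //; exact: measurable_funM.
  apply: (@measurable_Rintegral_param _ _ _ _ _ leb (fun p y : RL => h y * sin (s * p * y))).
  apply: measurable_funM => //.
  apply: (measurableT_comp (continuous_measurable_fun (@continuous_sin R))).
  by apply: measurable_funM => //; exact: measurable_funM.
pose e (k : nat) : R := k.+1%:R^-1.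
have e0 k : 0 < e k by rewrite invr_gt0.
pose g k (p : RL) : \bar R := (abelw (e k) p * (c p ^+ 2 + d p ^+ 2))%:E.
have g0 k p : setT p -> (0 <= g k p)%E.
  by move=> _; rewrite lee_fin mulr_ge0 ?abelw_ge0// addr_ge0// sqr_ge0.
have mgk k : measurable_fun setT (g k).
  by apply/measurable_EFinP; apply: measurable_funM => //; exact: measurable_abelw.
have nd p : setT p -> {homo g ^~ p : m n / (m <= n)%N >-> (m <= n)%E}.
  move=> _ m n mn; rewrite lee_fin ler_wpM2r//; first by rewrite addr_ge0// sqr_ge0.
  rewrite /abelw ler_expR lerN2 ler_wpM2r// /e lef_pV2 ?posrE//.
  by rewrite ler_nat.
have glim p : limn (g ^~ p) = (c p ^+ 2 + d p ^+ 2)%:E.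
  apply/cvg_lim => //; apply/fine_cvgP; split; first exact: nearW.
  rewrite -[X in _ --> X]mul1r; apply: cvgM; last exact: cvg_cst.
  rewrite -expR0 -oppr0 -(mul0r `|p|).
  apply: (@cvg_comp _ _ _ (fun k => - (e k * `|p|)) expR _ (nbhs (- (0 * `|p|)))); last exact: continuous_expR.
  by apply: cvgN; apply: cvgM; [exact: cvg_harmonic|exact: cvg_cst].
have := @cvg_monotone_convergence _ _ _ leb setT measurableT g mgk g0 nd.
under eq_integral do rewrite glim.
move=> /cvg_lim <- //; apply: lime_le.
  apply: ereal_nondecreasing_is_cvgn => m n mn; apply: ge0_le_integral => //.
  - by move=> p; exact: g0.
  - by move=> p _; exact: nd.
by apply: nearW => k; exact: abel_fourier_le.
Qed.

End BesselReal.

Section Bessel.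
Context (R : realType).
Local Notation C := R[i].
Local Notation leb := (@lebesgue_measure R).
Local Notation RL := (measurableTypeR R).

Lemma Cintegrable_expiM dT (T : measurableType dT) (m : {measure set T -> \bar R})
    (t : T -> R) (f : T -> C) :
  measurable_fun setT t -> Cintegrable m f -> Cintegrable m (fun x => expi (t x) * f x).
Proof.
move=> mt fi; have mf := Cintegrable_cmeas fi.
have nf := (CintegrableP m mf).1 fi.
apply: (@Cintegrable_le _ _ _ _ _ (fun x => 2 * cnorm1 (f x))).
- by apply: cmeasM => //; exact: cmeas_expi.
- by apply: measurable_funM => //; exact: measurable_cnorm1.
- by move=> x; rewrite (le_trans (cnorm1M _ _))// ler_wpM2r ?cnorm1_ge0 ?cnorm1_expi.
rewrite ge0_integralRZ//; first by rewrite lte_mul_pinfty.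
- by move=> x; exact: cnorm1_ge0.
- exact: measurable_cnorm1.
Qed.

Lemma expiMK (t : R) (z : C) : expi (- t) * (expi t * z) = z.
Proof. by rewrite mulrA -expiD addNr expi0 mul1r. Qed.

(** The real case is applied to the real and imaginary parts of [h]. Recombining them through (x +
    y)^2 <= 2 (x^2 + y^2) doubles the constant from 2 pi to 4 pi. *)
Lemma bessel1 (s : R) (h : RL -> C) : s != 0 -> Cintegrable leb h ->
  (sqint leb (fun p : RL => Cint leb (fun y : RL => expi (s * (p * y)) * h y)%R) <=
   (4 * pi / `|s|)%:E * sqint leb h)%E.
Proof.
move=> s0 [rh jh].
have mr : measurable_fun setT (fun y : RL => complex.Re (h y)).
  by apply/measurable_EFinP; exact: (measurable_int leb).
have mj : measurable_fun setT (fun y : RL => complex.Im (h y)).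
  by apply/measurable_EFinP; exact: (measurable_int leb).
pose c1 p := Rintegral leb setT (fun y : RL => complex.Re (h y) * cos (s * p * y)).
pose d1 p := Rintegral leb setT (fun y : RL => complex.Re (h y) * sin (s * p * y)).
pose c2 p := Rintegral leb setT (fun y : RL => complex.Im (h y) * cos (s * p * y)).
pose d2 p := Rintegral leb setT (fun y : RL => complex.Im (h y) * sin (s * p * y)).
have ib (f g : RL -> R) : leb.-integrable setT (fun y => (f y)%:E) ->
    measurable_fun setT g -> (forall y, `|g y| <= 1) ->
    leb.-integrable setT (fun y => (f y * g y)%:E).
  move=> fi mg g1.
  have mf : measurable_fun setT f by apply/measurable_EFinP; exact: (measurable_int leb fi).
  apply: le_integrable fi => //.
    by apply/measurable_EFinP; apply: measurable_funM.
  by move=> y _ /=; rewrite lee_fin normrM ler_piMr.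
have mc (t : R) : measurable_fun setT (fun y : RL => cos (t * y) : R).
  apply: (measurableT_comp (continuous_measurable_fun (@continuous_cos R))).
  exact: measurable_funM.
have ms (t : R) : measurable_fun setT (fun y : RL => sin (t * y) : R).
  apply: (measurableT_comp (continuous_measurable_fun (@continuous_sin R))).
  exact: measurable_funM.
have c_1 (x : R) : `|cos x| <= 1 by rewrite ler_norml cos_geN1 cos_le1.
have s_1 (x : R) : `|sin x| <= 1 by rewrite ler_norml sin_geN1 sin_le1.
have FE (p : RL) : Cint leb (fun y : RL => expi (s * (p * y)) * h y) =
    Complex (c1 p - d2 p) (c2 p + d1 p).
  rewrite /Cint; congr Complex.
    rewrite -RintegralB//; try exact: ib.
    congr Rintegral; apply/funext => y.
    by rewrite cReM (mulrA s p y) [complex.Re (expi _)]/= [complex.Im (expi _)]/=; ring.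
  rewrite -RintegralD//; try exact: ib.
  congr Rintegral; apply/funext => y.
  by rewrite cImM (mulrA s p y) [complex.Re (expi _)]/= [complex.Im (expi _)]/=; ring.
have mint (f : RL -> R) : measurable_fun setT f -> forall t : R -> R, measurable_fun setT t ->
    measurable_fun setT (fun p : RL => Rintegral leb setT (fun y : RL => f y * t (s * p * y))).
  move=> mf t mt.
  apply: (@measurable_Rintegral_param _ _ _ _ _ leb (fun p y : RL => f y * t (s * p * y))).
  apply: measurable_funM => //; first exact: measurableT_comp mf measurable_snd.
  apply: (measurableT_comp mt).
  by apply: measurable_funM => //; exact: measurable_funM.
have mcos : measurable_fun setT (@cos R) by apply: continuous_measurable_fun; exact: continuous_cos.
have msin : measurable_fun setT (@sin R) by apply: continuous_measurable_fun; exact: continuous_sin.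
have mc1 : measurable_fun setT (fun p : RL => c1 p) by exact: mint.
have md1 : measurable_fun setT (fun p : RL => d1 p) by exact: mint.
have mc2 : measurable_fun setT (fun p : RL => c2 p) by exact: mint.
have md2 : measurable_fun setT (fun p : RL => d2 p) by exact: mint.
have m1 : measurable_fun setT (fun p : RL => c1 p ^+ 2 + d1 p ^+ 2).
  by apply: measurable_funD; exact: measurable_funX.
have m2 : measurable_fun setT (fun p : RL => c2 p ^+ 2 + d2 p ^+ 2).
  by apply: measurable_funD; exact: measurable_funX.
have sq2 (x y : R) : 0 <= x ^+ 2 + y ^+ 2 by rewrite addr_ge0// sqr_ge0.
apply: (@le_trans _ _ (\int[leb]_p (2 * ((c1 p ^+ 2 + d1 p ^+ 2) + (c2 p ^+ 2 + d2 p ^+ 2)))%:E)%E).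
  apply: ge0_le_integralR.
  - by move=> p; exact: cabs2_ge0.
  - move=> p; rewrite FE /cabs2 /=.
    have := sqr_ge0 (c1 p + d2 p); have := sqr_ge0 (c2 p - d1 p); rewrite !expr2; lra.
  - under eq_fun do rewrite FE.
    apply: measurable_cabs2; split => /=; first exact: measurable_funB.
    exact: measurable_funD.
  - by apply: measurable_funM => //; exact: measurable_funD.
rewrite ge0_integralRZ//; last 2 first.
- by move=> p; rewrite addr_ge0.
- exact: measurable_funD.
rewrite ge0_integralRD//.
have b1 := bessel_real s0 mr rh; have b2 := bessel_real s0 mj jh.
apply: (@le_trans _ _ (2%:E * ((2 * pi / `|s|)%:E * \int[leb]_y (complex.Re (h y) ^+ 2)%:E
   + (2 * pi / `|s|)%:E * \int[leb]_y (complex.Im (h y) ^+ 2)%:E))%E).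
  by rewrite lee_pmul2l// leeD.
rewrite /sqint ge0_integralRD; try (by move=> y; rewrite sqr_ge0); try exact: measurable_funX.
rewrite -ge0_muleDr; try by rewrite integral_ge0// => y _; rewrite lee_fin sqr_ge0.
rewrite muleA -EFinM; rewrite (_ : 2 * (2 * pi / `|s|) = 4 * pi / `|s|)//; ring.
Qed.

Definition fourierv (n : nat) (s : R) (h : 'rV[R]_n -> C) (P : 'rV[R]_n) : C :=
  Cint (vol R n) (fun Y => expi (s * dotv P Y) * h Y).

Lemma cmeas_fourierv_param n s dT (T : measurableType dT) (h : T -> 'rV[R]_n -> C) :
  cmeas (fun q : T * 'rV[R]_n => h q.1 q.2) ->
  cmeas (fun q : T * 'rV[R]_n => fourierv s (h q.1) q.2).
Proof.
move=> mh; apply: (@cmeas_Cint_param _ _ _ _ _ (vol R n)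
  (fun (q : T * 'rV[R]_n) Y => expi (s * dotv q.2 Y) * h q.1 Y)).
apply: cmeasM.
  apply: cmeas_expi; apply: measurable_funM => //.
  apply: measurable_dotv => //; exact: measurableT_comp measurable_snd measurable_fst.
apply: (cmeas_comp mh (g := fun q : (T * 'rV[R]_n) * 'rV[R]_n => (q.1.1, q.2))).
apply: measurable_fun_pair => //; exact: measurableT_comp measurable_fst measurable_fst.
Qed.

Lemma cmeas_fourierv n s (h : 'rV[R]_n -> C) : cmeas h -> cmeas (fourierv s h).
Proof.
move=> mh; have := @cmeas_fourierv_param n s _ 'rV[R]_n (fun _ => h) _.
have mh2 : cmeas (fun q : 'rV[R]_n * 'rV[R]_n => h q.2) by exact: cmeas_comp mh measurable_snd.
move=> /(_ mh2) m2.
apply: (cmeas_comp m2 (g := fun P : 'rV[R]_n => (P, P))).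
exact: measurable_fun_pair.
Qed.

(** The partial transform [G y P] in the last n coordinates is transformed once more in y. For each
    [P] the one-variable inequality removes the outer transform, and for almost every y the
    induction hypothesis removes the inner one. Each coordinate contributes a factor 4 pi / |s|. *)
Lemma bessel_vec n (s : R) : s != 0 -> exists K : R, 0 <= K /\
  forall h : 'rV[R]_n -> C, Cintegrable (vol R n) h ->
    (sqint (vol R n) (fourierv s h) <= K%:E * sqint (vol R n) h)%E.
Proof.
move=> s0; elim: n => [|n [K [K0 IH]]].
  exists 1; split => // h hi; have mh := Cintegrable_cmeas hi.
  rewrite mul1e /sqint (ge0_integral_vol0 (F := fun P => (cabs2 (fourierv s h P))%:E)); last first.
    exact/measurable_EFinP/measurable_cabs2/cmeas_fourierv.
  rewrite (ge0_integral_vol0 (F := fun P => (cabs2 (h P))%:E)); last first.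
    exact/measurable_EFinP/measurable_cabs2.
  have [hi' hiE] : Cintegrable (vol R 0) h /\ Cint (vol R 0) h = h 0.
    by split=> //; rewrite -rintC_Cint// rintC0.
  rewrite lee_fin /fourierv (_ : (fun Y => _) = h) ?hiE//.
  by apply/funext => Y; rewrite /dotv big_ord0 mulr0 expi0 mul1r.
have c0 : 0 <= 4 * pi / `|s| by rewrite divr_ge0// mulr_ge0// pi_ge0.
exists (4 * pi / `|s| * K); split; first by rewrite mulr_ge0.
move=> h hi; have mh := Cintegrable_cmeas hi.
have [hci _] := Cint_transport (@measurable_consv R n) ltr01 (@ge0_integral_consv R n) hi.
have mhc : cmeas (fun p : RL * 'rV[R]_n => h (consv p)) := Cintegrable_cmeas hci.
pose H (y : RL) (Y : 'rV[R]_n) := h (consv (y, Y)).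
have mH : cmeas (fun q : RL * 'rV[R]_n => H q.1 q.2).
  by move: mhc; rewrite /H; congr cmeas; apply/funext => -[].
pose G (y : RL) (P : 'rV[R]_n) := fourierv s (H y) P.
have mG : cmeas (fun q : RL * 'rV[R]_n => G q.1 q.2) by exact: cmeas_fourierv_param.
(* Integrability of [G ^~ P] holds for every [P]: for each frequency, multiplying [h] by a bounded
   phase keeps it integrable on the product, and Fubini applies. *)
have FE (p : RL) (P : 'rV[R]_n) : Cintegrable leb (G ^~ P) /\
    fourierv s h (consv (p, P)) = Cint leb (fun y : RL => expi (s * (p * y)) * G y P).
  pose f1 (q : RL * 'rV[R]_n) := expi (s * dotv P q.2) * h (consv q).
  have if1 : Cintegrable (prodm leb (vol R n)) f1.
    apply: Cintegrable_expiM => //.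
    apply: measurable_funM => //.
    exact: (measurable_dotv (measurable_cst P) measurable_snd).
  split; first by have [] := Cint_fubini if1.
  rewrite /fourierv.
  pose f2 (q : RL * 'rV[R]_n) := expi (s * (p * q.1)) * f1 q.
  have if2 : Cintegrable (prodm leb (vol R n)) f2.
    apply: Cintegrable_expiM => //.
    by apply: measurable_funM => //; exact: measurable_funM.
  have if3 : Cintegrable (vol R n.+1) (fun Y => expi (s * dotv (consv (p, P)) Y) * h Y).
    apply: Cintegrable_expiM => //.
    apply: measurable_funM => //.
    exact: (measurable_dotv (measurable_cst (consv (p, P))) (@measurable_id _ _ setT)).
  have [_ ->] := Cint_transport (@measurable_consv R n) ltr01 (@ge0_integral_consv R n) if3.
  rewrite RtoC1 mul1r.
  have -> : (fun q => expi (s * dotv (consv (p, P)) (consv q)) * h (consv q)) = f2.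
    by apply/funext => q; rewrite dotv_consv /f2 /f1 mulrDr expiD -mulrA.
  have mg : cmeas (fun y : RL => expi (s * (p * y)) * G y P).
    apply: cmeasM.
      by apply: cmeas_expi; apply: measurable_funM => //; exact: measurable_funM.
    apply: (cmeas_comp mG (g := fun y : RL => (y, P))).
    exact: measurable_fun_pair.
  have [] // := ae_eq_Cint_param if2 mg.
  move=> y iy; rewrite /f2 /f1 /=; apply/esym; rewrite CintZ//.
  (* Multiplying back by the inverse phase recovers integrability of the inner slice, which [CintZ]
     asks for. *)
  have := CintegrableZ (expi (- (s * (p * y)))) iy.
  by rewrite /f2 /f1 /=; under eq_fun do rewrite expiMK.
have mFh := cmeas_fourierv s mh.
(* Slices of [h] itself are integrable only for almost every y, so the induction hypothesis is used
   under an almost everywhere comparison of integrals. *)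
have aeH : {ae leb, forall y : RL, Cintegrable (vol R n) (H y)}.
  have [rc jc] := hci.
  by apply: filterS2 (ae_integrable1 rc) (ae_integrable1 jc) => y; split.
rewrite /sqint ge0_integral_volS; last 2 first.
- exact/measurable_EFinP/measurable_cabs2.
- by move=> P; rewrite lee_fin cabs2_ge0.
have mFc : cmeas (fun q : RL * 'rV[R]_n => fourierv s h (consv q)).
  exact: cmeas_comp mFh (@measurable_consv R n).
rewrite (@ge0_integral_swap _ _ _ _ _ leb (vol R n)
  (fun x P => (cabs2 (fourierv s h (consv (x, P))))%:E)); last 2 first.
- apply/measurable_EFinP; apply: measurable_cabs2.
  by move: mFc; congr cmeas; apply/funext => -[].
- by move=> x P; rewrite lee_fin cabs2_ge0.
have mGsw : measurable_fun setT (fun q : 'rV[R]_n * RL => (cabs2 (G q.2 q.1))%:E).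
  apply/measurable_EFinP; apply: measurable_cabs2.
  apply: (cmeas_comp mG (g := fun q : 'rV[R]_n * RL => (q.2, q.1))).
  exact: measurable_fun_pair.
have mGi : measurable_fun setT (fun P : 'rV[R]_n => (\int[leb]_y (cabs2 (G y P))%:E)%E).
  apply: (@measurable_ge0_integral _ _ _ _ _ leb (fun P y => (cabs2 (G y P))%:E)) => //.
  by move=> P y; rewrite lee_fin cabs2_ge0.
apply: (@le_trans _ _ (\int[vol R n]_P ((4 * pi / `|s|)%:E * \int[leb]_y (cabs2 (G y P))%:E))%E).
  apply: ge0_le_integral => //.
  - by move=> P _; apply: integral_ge0 => x _; rewrite lee_fin cabs2_ge0.
  - apply: (@measurable_ge0_integral _ _ _ _ _ leb (fun P x => (cabs2 (fourierv s h (consv (x, P))))%:E)).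
      apply/measurable_EFinP; apply: measurable_cabs2.
      apply: (cmeas_comp mFc (g := fun q : 'rV[R]_n * RL => (q.2, q.1))).
      exact: measurable_fun_pair.
    by move=> P y; rewrite lee_fin cabs2_ge0.
  - exact: measurable_funeM.
  - move=> P _; under eq_integral do rewrite (FE _ P).2.
    exact: (bessel1 s0 (FE 0 P).1).
rewrite ge0_integralZl_EFin//; last first.
  by move=> P _; apply: integral_ge0 => x _; rewrite lee_fin cabs2_ge0.
rewrite (EFinM (4 * pi / `|s|) K) -muleA lee_wpmul2l ?lee_fin//.
rewrite (@ge0_integral_swap _ _ _ _ _ (vol R n) leb (fun P y => (cabs2 (G y P))%:E))//; last first.
  by move=> P y; rewrite lee_fin cabs2_ge0.
rewrite ge0_integral_volS; last 2 first.
- exact/measurable_EFinP/measurable_cabs2.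
- by move=> P; rewrite lee_fin cabs2_ge0.
have mHi : measurable_fun setT (fun y : RL => (\int[vol R n]_v (cabs2 (H y v))%:E)%E).
  apply: (@measurable_ge0_integral _ _ _ _ _ (vol R n) (fun y v => (cabs2 (H y v))%:E)) => //.
    exact/measurable_EFinP/measurable_cabs2.
  by move=> y v; rewrite lee_fin cabs2_ge0.
rewrite -ge0_integralZl_EFin//; last first.
  by move=> y _; apply: integral_ge0 => x _; rewrite lee_fin cabs2_ge0.
apply: ae_ge0_le_integral => //.
- by move=> y _; apply: integral_ge0 => x _; rewrite lee_fin cabs2_ge0.
- apply: (@measurable_ge0_integral _ _ _ _ _ (vol R n) (fun y P => (cabs2 (G y P))%:E)) => //.
    exact/measurable_EFinP/measurable_cabs2.
  by move=> P y; rewrite lee_fin cabs2_ge0.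
- move=> y _; rewrite mule_ge0//.
  by apply: integral_ge0 => x _; rewrite lee_fin cabs2_ge0.
- exact: measurable_funeM.
by apply: filterS aeH => y Hy _; exact: IH.
Qed.

End Bessel.

(** * Wigner transforms and the Weyl form *)

Section Wigner.
Context (R : realType) (n : nat) (eta : R).
Hypothesis eta0 : eta != 0.
Local Notation C := R[i].
Local Notation V := 'rV[R]_n.
Local Notation Z := 'rV[R]_(n + n).
Local Notation vn := (vol R n).
Local Notation v2n := (vol R (n + n)).
Implicit Types (f g : V -> C) (X P Y : V) (z : Z).

Lemma Lsq_expiM dT (T : measurableType dT) (m : {measure set T -> \bar R})
    (t : T -> R) (f : T -> C) :
  measurable_fun setT t -> Lsq m f -> Lsq m (fun x => expi (t x) * f x).
Proof.
move=> mt [mf nf]; split; first by apply: cmeasM => //; exact: cmeas_expi.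
by rewrite /sqint; under eq_integral do rewrite cabs2M cabs2_expi mul1r.
Qed.

Definition ambig f g X Y : C := f (X + 2^-1 *: Y) * conjc (g (X - 2^-1 *: Y)).

Let half0 : 2^-1 != 0 :> R. Proof. by rewrite invr_eq0 pnatr_eq0. Qed.

Lemma Lsq_ambig_l f X : Lsq vn f -> Lsq vn (fun Y => f (X + 2^-1 *: Y)).
Proof. by move=> Lf; under eq_fun do rewrite addrC; exact: Lsq_vol_affine. Qed.

Lemma Lsq_ambig_r g X : Lsq vn g -> Lsq vn (fun Y => conjc (g (X - 2^-1 *: Y))).
Proof.
move=> Lg; apply: LsqJ; under eq_fun do rewrite addrC -scaleNr.
by apply: Lsq_vol_affine => //; rewrite oppr_eq0.
Qed.

(** This holds for every [X], not merely almost every one, so [bessel_vec] applies pointwise in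
    [X]. *)
Lemma Cintegrable_ambig f g X : Lsq vn f -> Lsq vn g -> Cintegrable vn (ambig f g X).
Proof. by move=> Lf Lg; apply: LsqM; [exact: Lsq_ambig_l|exact: Lsq_ambig_r]. Qed.

Let s : R := - eta^-1.
Let s0 : s != 0. Proof. by rewrite oppr_eq0 invr_eq0. Qed.

Lemma Cintegrable_wigner f g X P : Lsq vn f -> Lsq vn g ->
  Cintegrable vn (fun Y => expi (s * dotv P Y) * ambig f g X Y).
Proof.
move=> Lf Lg; apply: Cintegrable_expiM; last exact: Cintegrable_ambig.
apply: measurable_funM => //; exact: (measurable_dotv (measurable_cst P) (@measurable_id _ _ setT)).
Qed.

Lemma wignerE f g X P : Lsq vn f -> Lsq vn g ->
  wigner eta f g X P = RtoC ((2 * pi * eta) ^- n) * fourierv (- eta^-1) (ambig f g X) P.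
Proof.
move=> Lf Lg; rewrite /wigner; congr (_ * _).
rewrite /fourierv -rintC_Cint; last exact: Cintegrable_wigner.
congr rintC; apply/funext => Y; rewrite -mulrA; congr (expi _ * _).
by rewrite /s; field.
Qed.

Definition wig f g z : C := wigner eta f g (lsubmx z) (rsubmx z).

Lemma cmeas_ambig f g : cmeas f -> cmeas g ->
  cmeas (fun q : V * V => ambig f g q.1 q.2).
Proof.
move=> mf mg; apply: cmeasM; last apply: cmeasJ.
  apply: (cmeas_comp mf (g := fun q : V * V => q.1 + 2^-1 *: q.2)).
  by apply: measurable_addv => //; exact: measurable_scalev.
apply: (cmeas_comp mg (g := fun q : V * V => q.1 - 2^-1 *: q.2)).
by apply: measurable_subv => //; exact: measurable_scalev.
Qed.

Lemma cmeas_fourier_ambig f g : cmeas f -> cmeas g ->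
  cmeas (fun z : Z => fourierv s (ambig f g (lsubmx z)) (rsubmx z)).
Proof.
move=> mf mg.
apply: (cmeas_comp (cmeas_fourierv_param s (cmeas_ambig mf mg))
  (g := fun z : Z => (lsubmx z, rsubmx z))).
by apply: measurable_fun_pair; [exact: measurable_lsubmx|exact: measurable_rsubmx].
Qed.

(** The map from (X, Y) to (X + Y / 2, X - Y / 2) preserves volume. It is carried out by scalar
    substitutions: u = X + Y / 2 at fixed X contributes 2^n and turns X - Y / 2 into 2 X - u; then v
    = 2 X - u at fixed u gives that factor back. *)
Lemma ambig_norm f g : Lsq vn f -> Lsq vn g ->
  (\int[vn]_X sqint vn (ambig f g X) = sqint vn f * sqint vn g)%E.
Proof.
move=> [mf nf] [mg ng].
have mf2 := measurable_cabs2 mf; have mg2 := measurable_cabs2 mg.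
have two0 : 2 != 0 :> R by rewrite pnatr_eq0.
have msub : measurable_fun setT (fun q : V * V => 2 *: q.1 - q.2).
  by apply: measurable_subv => //; exact: measurable_scalev.
have mgg : measurable_fun setT (fun q : V * V => cabs2 (g (2 *: q.1 - q.2))).
  exact: measurableT_comp mg2 msub.
pose F X Y := (cabs2 (f Y) * cabs2 (g (2 *: X - Y)))%:E.
have mfg : measurable_fun setT (fun q : V * V => F q.1 q.2).
  apply/measurable_EFinP; apply: measurable_funM => //.
  exact: measurableT_comp mf2 measurable_snd.
have pos (X Y : V) : (0 <= F X Y)%E by rewrite lee_fin mulr_ge0// cabs2_ge0.
have E1 X : sqint vn (ambig f g X) = ((2 ^+ n)%:E * \int[vn]_u F X u)%E.
  rewrite (ge0_integral_vol_affine X half0 (measurable_curry1 mfg X) (pos X)).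
  rewrite muleA -EFinM ger0_norm ?invr_ge0// -exprMn divff// expr1n mul1e.
  apply: eq_integral => Y _; rewrite /ambig /F cabs2M cabs2J (addrC X); congr (_ * cabs2 (g _))%:E.
  by apply/rowP => i; rewrite !mxE; ring.
under eq_integral do rewrite E1.
rewrite ge0_integralZl_EFin ?exprn_ge0//; last 2 first.
- by move=> X _; apply: integral_ge0 => u _; exact: pos.
- exact: (measurable_ge0_integral vn mfg).
rewrite (ge0_integral_swap vn vn mfg)//.
have sg : (sqint vn g = (2 ^+ n)%:E * sqint vn (fun X => g (2 *: X - 0)%R))%E.
  by rewrite (sqint_vol_affine (- 0) two0 mg) ger0_norm.
have E2 (u : V) : ((2 ^+ n)%:E * \int[vn]_X F X u = sqint vn g * (cabs2 (f u))%:E)%E.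
  have mgu : cmeas (fun X => g (2 *: X - u)).
    apply: (cmeas_comp mg (g := fun X : V => 2 *: X - u)).
    by apply: measurable_subv => //; exact: measurable_scalev.
  rewrite ge0_integralRZ ?cabs2_ge0//; last 2 first.
  - by move=> X; exact: cabs2_ge0.
  - exact: measurable_cabs2.
  rewrite muleCA muleC; congr (_ * _)%E.
  by rewrite [RHS](sqint_vol_affine (- u) two0 mg) ger0_norm.
rewrite -ge0_integralZl_EFin ?exprn_ge0//; last 2 first.
- by move=> u _; apply: integral_ge0 => X _; exact: pos.
- apply: (measurable_ge0_integral vn (f := fun u X => F X u)) => //.
  apply: (measurableT_comp mfg (g := fun q : V * V => (q.2, q.1))).
  exact: measurable_fun_pair.
under eq_integral do rewrite E2.
have g0 := sqint_ge0 vn g.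
rewrite -(@fineK _ (sqint vn g)) ?ge0_fin_numE// muleC.
under eq_integral do rewrite -EFinM.
rewrite ge0_integralRZ ?fine_ge0//.
by move=> u; exact: cabs2_ge0.
Qed.

(* Only the boundedness of the cross-Wigner transform is needed, so the constant
   of Moyal's identity is left unspecified. *)
Lemma moyal_le : exists K : R, 0 <= K /\ forall f g, Lsq vn f -> Lsq vn g ->
  Lsq v2n (wig f g) /\ sqn v2n (wig f g) <= K * (sqn vn f * sqn vn g).
Proof.
have [K [K0 HK]] := bessel_vec n s0.
pose c := (2 * pi * eta) ^- n.
exists (c ^+ 2 * K); split; first by rewrite mulr_ge0// sqr_ge0.
move=> f g Lf Lg; have [mf nf] := Lf; have [mg ng] := Lg.
have wE : wig f g = fun z => RtoC c * fourierv s (ambig f g (lsubmx z)) (rsubmx z).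
  by apply/funext => z; rewrite /wig wignerE.
have mF := cmeas_fourier_ambig mf mg.
have mw : cmeas (wig f g) by rewrite wE; apply: cmeasM => //; exact: cmeas_cst.
suff le : (sqint v2n (wig f g) <= (c ^+ 2 * K * (sqn vn f * sqn vn g))%:E)%E.
  have Lw : Lsq v2n (wig f g) by split => //; rewrite (le_lt_trans le)// ltry.
  by split => //; rewrite -lee_fin sqnE.
rewrite wE sqintZ// cabs2_RtoC -mulrA (EFinM (c ^+ 2)) lee_wpmul2l ?lee_fin ?sqr_ge0//.
rewrite (EFinM K) (EFinM (sqn vn f)) !sqnE// -ambig_norm//.
rewrite /sqint ge0_integral_vol_split; last 2 first.
- exact/measurable_EFinP/measurable_cabs2.
- by move=> z; rewrite lee_fin cabs2_ge0.
have mamb : measurable_fun setT (fun q : V * V => (cabs2 (ambig f g q.1 q.2))%:E).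
  exact/measurable_EFinP/measurable_cabs2/cmeas_ambig.
rewrite -ge0_integralZl_EFin//; last 2 first.
- by move=> X _; exact: sqint_ge0.
- apply: (measurable_ge0_integral vn (f := fun X Y => (cabs2 (ambig f g X Y))%:E)) => //.
  by move=> X Y; rewrite lee_fin cabs2_ge0.
apply: ge0_le_integral => //.
- by move=> X _; apply: integral_ge0 => Y _; rewrite lee_fin cabs2_ge0.
- apply: (measurable_ge0_integral vn (f := fun X P =>
    (cabs2 (fourierv s (ambig f g (lsubmx (row_mx X P))) (rsubmx (row_mx X P))))%:E)).
    apply/measurable_EFinP; apply: measurable_cabs2.
    apply: (cmeas_comp mF (g := fun q : V * V => row_mx q.1 q.2)).
    exact: measurable_row_mx.
  by move=> X P; rewrite lee_fin cabs2_ge0.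
- apply: measurable_funeM.
  apply: (measurable_ge0_integral vn (f := fun X Y => (cabs2 (ambig f g X Y))%:E)) => //.
  by move=> X Y; rewrite lee_fin cabs2_ge0.
move=> X _; apply: le_trans (HK _ (Cintegrable_ambig X Lf Lg)).
rewrite le_eqVlt; apply/orP; left; apply/eqP; apply: eq_integral => P _ /=.
by rewrite row_mxKl row_mxKr.
Qed.

End Wigner.

Section DotProduct.
Context (R : realType) (d : nat).
Implicit Types (u v w : 'rV[R]_d) (c : R).

Lemma dotvC u v : dotv u v = dotv v u.
Proof. by apply: eq_bigr => i _; rewrite mulrC. Qed.

Lemma dotvDr u v w : dotv u (v + w) = dotv u v + dotv u w.
Proof. by rewrite /dotv -big_split; apply: eq_bigr => i _; rewrite mxE mulrDr. Qed.

Lemma dotvZr c u v : dotv u (c *: v) = c * dotv u v.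
Proof. by rewrite /dotv big_distrr; apply: eq_bigr => i _; rewrite mxE mulrCA. Qed.

Lemma dotvNr u v : dotv u (- v) = - dotv u v.
Proof. by rewrite -scaleN1r dotvZr mulN1r. Qed.

Lemma dotvDl u v w : dotv (v + w) u = dotv v u + dotv w u.
Proof. by rewrite !(dotvC _ u) dotvDr. Qed.

Lemma dotvZl c u v : dotv (c *: v) u = c * dotv v u.
Proof. by rewrite !(dotvC _ u) dotvZr. Qed.

Lemma dotvNl u v : dotv (- v) u = - dotv v u.
Proof. by rewrite !(dotvC _ u) dotvNr. Qed.

Definition dotvE := (dotvDr, dotvDl, dotvNr, dotvNl, dotvZr, dotvZl).

Lemma dotv_ge0 u : 0 <= dotv u u.
Proof. by rewrite sumr_ge0// => i _; rewrite -expr2 sqr_ge0. Qed.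

End DotProduct.

Lemma dotv_row_mx (R : realType) n m (u u' : 'rV[R]_n) (v v' : 'rV[R]_m) :
  dotv (row_mx u v) (row_mx u' v') = dotv u u' + dotv v v'.
Proof.
rewrite /dotv big_split_ord /=; congr (_ + _); apply: eq_bigr => i _.
  by rewrite !row_mxEl.
by rewrite !row_mxEr.
Qed.

Lemma symplE (R : realType) n (z w : 'rV[R]_(n + n)) :
  sympl z w = dotv (rsubmx z) (lsubmx w) - dotv (rsubmx w) (lsubmx z).
Proof.
rewrite /sympl /Jmap -[X in dotv _ X](hsubmxK w) dotv_row_mx dotvNl.
by rewrite (dotvC (lsubmx z)).
Qed.

Section SubmxLinear.
Context (R : realType) (n : nat).
Implicit Types (u v : 'rV[R]_(n + n)) (c : R).

Lemma lsubmxD u v : lsubmx (u + v) = lsubmx u + lsubmx v.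
Proof. exact: linearD. Qed.
Lemma rsubmxD u v : rsubmx (u + v) = rsubmx u + rsubmx v.
Proof. exact: linearD. Qed.
Lemma lsubmxN u : lsubmx (- u) = - lsubmx u.
Proof. exact: linearN. Qed.
Lemma rsubmxN u : rsubmx (- u) = - rsubmx u.
Proof. exact: linearN. Qed.
Lemma lsubmxZ c u : lsubmx (c *: u) = c *: lsubmx u.
Proof. exact: linearZ. Qed.
Lemma rsubmxZ c u : rsubmx (c *: u) = c *: rsubmx u.
Proof. exact: linearZ. Qed.

Definition halfmxE := (lsubmxD, rsubmxD, lsubmxN, rsubmxN, lsubmxZ, rsubmxZ).

End SubmxLinear.

Section WignerAlgebra.
Context (R : realType) (n : nat) (eta : R).
Hypothesis eta0 : eta != 0.
Local Notation C := R[i].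
Local Notation V := 'rV[R]_n.
Local Notation Z := 'rV[R]_(n + n).
Local Notation vn := (vol R n).
Implicit Types (f g : V -> C) (X P Y : V) (z l m : Z).

Let wigE f g z : Lsq vn f -> Lsq vn g -> wig eta f g z =
  RtoC ((2 * pi * eta) ^- n) *
  Cint vn (fun Y => expi (- eta^-1 * dotv (rsubmx z) Y) * ambig f g (lsubmx z) Y).
Proof. by move=> Lf Lg; rewrite /wig wignerE. Qed.

Lemma wigDl f1 f2 g z : Lsq vn f1 -> Lsq vn f2 -> Lsq vn g ->
  wig eta (fun x => f1 x + f2 x) g z = wig eta f1 g z + wig eta f2 g z.
Proof.
move=> L1 L2 Lg; have L12 := LsqD L1 L2.
rewrite !wigE// -mulrDr -CintD; try exact: Cintegrable_wigner.
by congr (_ * _); congr Cint; apply/funext => Y; rewrite /ambig; ring.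
Qed.

Lemma wigZl c f g z : Lsq vn f -> Lsq vn g ->
  wig eta (fun x => c * f x) g z = c * wig eta f g z.
Proof.
move=> Lf Lg; have Lcf := LsqZ c Lf.
rewrite !wigE// mulrCA -(CintZ c); last exact: Cintegrable_wigner.
by congr (_ * _); congr Cint; apply/funext => Y; rewrite /ambig; ring.
Qed.

(** Conjugation reverses the phase and exchanges the two factors; the reflection of Y to - Y undoes
    both. *)
Lemma wigJ f g z : Lsq vn f -> Lsq vn g -> conjc (wig eta f g z) = wig eta g f z.
Proof.
move=> Lf Lg; rewrite !wigE// conjM conj_RtoC.
rewrite -CintJ; last exact: Cintegrable_wigner.
have N1 : -1 != 0 :> R by rewrite oppr_eq0 oner_eq0.
have [_ ->] := Cint_vol_affine 0 N1 (Cintegrable_wigner eta (lsubmx z) (rsubmx z) Lg Lf).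
rewrite normrN normr1 expr1n RtoC1 mul1r; congr (_ * _); congr Cint; apply/funext => Y; rewrite addr0 scaleN1r dotvNr mulrN /ambig !conjM conjc_expi conjcK.
by rewrite scalerN opprK; congr (_ * _); rewrite mulrC.
Qed.

Lemma Lsq_heis l f : Lsq vn f -> Lsq vn (heis eta l f).
Proof.
move=> Lf; rewrite /heis; apply: Lsq_expiM.
  apply: measurable_funM => //; apply: measurable_funB => //.
  exact: (measurable_dotv (measurable_cst (rsubmx l)) (@measurable_id _ _ setT)).
under eq_fun do rewrite -[X in f (X - _)]scale1r.
by apply: Lsq_vol_affine => //; rewrite oner_eq0.
Qed.

(** Shifting Y by the difference of the position parts of [l] and [m] puts both displaced arguments
    symmetrically around X minus the mean of these positions. The rest is a comparison of
    exponents. *)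
Lemma wig_heis l m f z : Lsq vn f ->
  wig eta (heis eta l f) (heis eta m f) z =
  expi (- sympl l m / (2 * eta)) * (expi (- sympl z (l - m) / eta) *
    wig eta f f (z - 2^-1 *: (l + m))).
Proof.
move=> Lf; have Ll := Lsq_heis l Lf; have Lm := Lsq_heis m Lf.
rewrite !wigE//.
set X := lsubmx z; set P := rsubmx z.
set xl := lsubmx l; set pl := rsubmx l; set xm := lsubmx m; set pm := rsubmx m.
have one0 : 1 != 0 :> R by rewrite oner_eq0.
have [_ ->] := Cint_vol_affine (xl - xm) one0 (Cintegrable_wigner eta X P Ll Lm).
rewrite normr1 expr1n RtoC1 mul1r.
rewrite [RHS]mulrA [RHS]mulrCA; congr (_ * _).
rewrite -expiD -CintZ; last exact: Cintegrable_wigner.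
congr Cint; apply/funext => Y; rewrite scale1r.
have lE : lsubmx (z - 2^-1 *: (l + m)) = X - 2^-1 *: (xl + xm).
  by rewrite !halfmxE.
have rE : rsubmx (z - 2^-1 *: (l + m)) = P - 2^-1 *: (pl + pm).
  by rewrite !halfmxE.
rewrite lE rE /ambig /heis -/xl -/xm -/pl -/pm.
rewrite conjM conjc_expi.
have -> : X + 2^-1 *: (Y + (xl - xm)) - xl = X - 2^-1 *: (xl + xm) + 2^-1 *: Y.
  by apply/rowP => i; rewrite !mxE; field.
have -> : X - 2^-1 *: (Y + (xl - xm)) - xm = X - 2^-1 *: (xl + xm) - 2^-1 *: Y.
  by apply/rowP => i; rewrite !mxE; field.
set F := f _; set G := conjc (f _).
have -> (a b c : R) : expi a * (expi b * F * (expi c * G)) = expi (a + b + c) * (F * G).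
  by rewrite !expiD; ring.
rewrite [RHS]mulrA -expiD; congr (expi _ * _).
rewrite !symplE !halfmxE -/xl -/xm -/pl -/pm -/X -/P !dotvE.
by field.
Qed.

End WignerAlgebra.

Section WeylForm.
Context (R : realType) (n : nat) (eta : R).
Hypothesis eta0 : eta != 0.
Local Notation C := R[i].
Local Notation V := 'rV[R]_n.
Local Notation Z := 'rV[R]_(n + n).
Local Notation vn := (vol R n).
Local Notation v2n := (vol R (n + n)).
Variable a : Z -> R.
Hypothesis La : Lsq v2n (fun z => RtoC (a z)).
Implicit Types (f g : V -> C) (z l m : Z).

Definition weylB f g : C := Cint v2n (fun z => RtoC (a z) * wig eta f g z).

Lemma Lsq_wig f g : Lsq vn f -> Lsq vn g -> Lsq v2n (wig eta f g).
Proof. by have [K [_ HK]] := moyal_le n eta0; move=> Lf Lg; have [] := HK f g Lf Lg. Qed.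

Lemma Cintegrable_weylB f g : Lsq vn f -> Lsq vn g ->
  Cintegrable v2n (fun z => RtoC (a z) * wig eta f g z).
Proof. by move=> Lf Lg; apply: LsqM => //; exact: Lsq_wig. Qed.

Lemma weyl_quadE f : Lsq vn f -> weyl_quad eta a f = weylB f f.
Proof. by move=> Lf; rewrite /weyl_quad rintC_Cint//; exact: Cintegrable_weylB. Qed.

Lemma weylBDl f1 f2 g : Lsq vn f1 -> Lsq vn f2 -> Lsq vn g ->
  weylB (fun x => f1 x + f2 x) g = weylB f1 g + weylB f2 g.
Proof.
move=> L1 L2 Lg; rewrite /weylB -CintD; try exact: Cintegrable_weylB.
by congr Cint; apply/funext => z; rewrite wigDl// mulrDr.
Qed.

Lemma weylBZl c f g : Lsq vn f -> Lsq vn g ->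
  weylB (fun x => c * f x) g = c * weylB f g.
Proof.
move=> Lf Lg; rewrite /weylB -CintZ; last exact: Cintegrable_weylB.
by congr Cint; apply/funext => z; rewrite wigZl// mulrCA.
Qed.

(** Hermitian symmetry reflects that the symbol is real. It transfers linearity on the left to
    conjugate linearity on the right, and makes the diagonal values real. *)
Lemma weylBJ f g : Lsq vn f -> Lsq vn g -> conjc (weylB f g) = weylB g f.
Proof.
move=> Lf Lg; rewrite /weylB -CintJ; last exact: Cintegrable_weylB.
by congr Cint; apply/funext => z; rewrite conjM conj_RtoC wigJ.
Qed.

Lemma weylBDr f1 f2 g : Lsq vn f1 -> Lsq vn f2 -> Lsq vn g ->
  weylB g (fun x => f1 x + f2 x) = weylB g f1 + weylB g f2.
Proof.
move=> L1 L2 Lg; have L12 := LsqD L1 L2.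
by rewrite -!(weylBJ _ Lg)// weylBDl// rmorphD.
Qed.

Lemma weylBZr c f g : Lsq vn f -> Lsq vn g ->
  weylB g (fun x => c * f x) = conjc c * weylB g f.
Proof.
move=> Lf Lg; have Lcf := LsqZ c Lf.
by rewrite -!(weylBJ _ Lg)// weylBZl// conjM.
Qed.

Lemma weylB0l g : Lsq vn g -> weylB (fun=> 0) g = 0.
Proof.
move=> Lg; have -> : (fun=> 0) = (fun x => 0 * (fun=> 0) x) :> (V -> C).
  by apply/funext => x; rewrite mul0r.
by rewrite weylBZl ?mul0r//; exact: Lsq0.
Qed.

Lemma weylB_suml (I : Type) (r : seq I) (F : I -> V -> C) g :
  (forall i, Lsq vn (F i)) -> Lsq vn g ->
  weylB (fun x => \sum_(i <- r) F i x) g = \sum_(i <- r) weylB (F i) g.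
Proof.
move=> LF Lg; elim: r => [|i r IH].
  by under eq_fun do rewrite big_nil; rewrite big_nil weylB0l.
under eq_fun do rewrite big_cons.
by rewrite weylBDl ?big_cons ?IH//; exact: Lsq_sum.
Qed.

Lemma weylB_sumr (I : Type) (r : seq I) (F : I -> V -> C) g :
  (forall i, Lsq vn (F i)) -> Lsq vn g ->
  weylB g (fun x => \sum_(i <- r) F i x) = \sum_(i <- r) weylB g (F i).
Proof.
move=> LF Lg; elim: r => [|i r IH].
  under eq_fun do rewrite big_nil.
  by rewrite big_nil -weylBJ// ?weylB0l// ?conjc0//; exact: Lsq0.
under eq_fun do rewrite big_cons.
by rewrite weylBDr ?big_cons ?IH//; exact: Lsq_sum.
Qed.

Lemma weylB_le : exists K : R, 0 <= K /\ forall f g, Lsq vn f -> Lsq vn g ->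
  cabs2 (weylB f g) <= K * (sqn vn f * sqn vn g).
Proof.
have [K [K0 HK]] := moyal_le n eta0.
exists (16 * sqn v2n (fun z => RtoC (a z)) * K); split.
  by rewrite !mulr_ge0// sqn_ge0.
move=> f g Lf Lg; have [Lw w_le] := HK f g Lf Lg.
apply: (le_trans (cabs2_Cint_le La Lw)).
by rewrite -!mulrA ler_wpM2l// ler_wpM2l ?sqn_ge0.
Qed.

Lemma McoefE (phi : V -> C) l m : Lsq vn phi ->
  Mcoef eta a phi l m = weylB (heis eta l phi) (heis eta m phi).
Proof.
move=> Lp; have Ll := Lsq_heis eta l Lp; have Lm := Lsq_heis eta m Lp.
pose F z := expi (- sympl z (l - m) / eta) * RtoC (a z) * Wfun eta phi (z - 2^-1 *: (l + m)).
have FE z : RtoC (a z) * wig eta (heis eta l phi) (heis eta m phi) z =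
    expi (- sympl l m / (2 * eta)) * F z.
  by rewrite wig_heis// /F /wig -/(Wfun _ _ _); ring.
(* Integrability of the integrand of [Mcoef] is inherited from the form on displaced windows by
   removing the unit factor in front. *)
have iF : Cintegrable v2n F.
  have := CintegrableZ (expi (- (- sympl l m / (2 * eta)))) (Cintegrable_weylB Ll Lm).
  by under eq_fun do rewrite FE expiMK.
rewrite /Mcoef /weylB rintC_Cint//.
by rewrite -CintZ//; congr Cint; apply/funext => z; rewrite FE.
Qed.

Lemma weylB_sum (phi : V -> C) (r : seq Z) (zeta : Z -> C) : Lsq vn phi ->
  let psi := fun x => \sum_(l <- r) zeta l * heis eta l phi x in
  weylB psi psi =
  \sum_(l <- r) \sum_(m <- r) zeta l * conjc (zeta m) * Mcoef eta a phi l m.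
Proof.
move=> Lp psi.
have LF l : Lsq vn (fun x => zeta l * heis eta l phi x) by apply: LsqZ; exact: Lsq_heis.
have Lpsi : Lsq vn psi by exact: Lsq_sum.
rewrite {1}/psi weylB_suml//; apply: eq_bigr => l _.
rewrite weylBZl//; last exact: Lsq_heis.
rewrite /psi weylB_sumr//; last exact: Lsq_heis.
rewrite big_distrr /=; apply: eq_bigr => m _.
by rewrite weylBZr ?McoefE ?mulrA//; exact: Lsq_heis.
Qed.

End WeylForm.

(** * The matrix M' as a multiple of M *)

Section CrossWignerMatrix.
Context (R : realType) (n : nat) (eta : R).
Hypothesis eta0 : eta != 0.
Local Notation C := R[i].
Local Notation V := 'rV[R]_n.
Local Notation Z := 'rV[R]_(n + n).
Local Notation vn := (vol R n).
Local Notation v2n := (vol R (n + n)).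
Variable a : Z -> R.
Hypothesis La : Lsq v2n (fun z => RtoC (a z)).

(** Since eta may be negative, positivity comes from the exponent n + n being even. *)
Lemma Mcoef'_const_gt0 : 0 < (2 * pi * eta) ^- (n + n) * 2 ^+ (n + n).
Proof.
have pe0 : 2 * pi * eta != 0 by rewrite !mulf_neq0// gt_eqF// pi_gt0.
rewrite mulr_gt0 ?exprn_gt0// invr_gt0 exprD -expr2 lt_neqAle sqr_ge0 andbT.
by rewrite eq_sym sqrf_eq0 expf_neq0.
Qed.

(** The first argument (l + m) / 4 is chosen so that 2 X = (l + m) / 2: with z = X + Y / 2, the
    window argument z - (l + m) / 2 is then - (X - Y / 2), as in the reflected window. The
    conjugation there is harmless because [wig eta phi phi] is real. The factor 2^(2n) is the
    Jacobian of z as a function of Y. *)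
Lemma Mcoef'E (phi : V -> C) (l m : Z) : Lsq vn phi ->
  Mcoef' eta a phi l m =
  RtoC ((2 * pi * eta) ^- (n + n) * 2 ^+ (n + n)) * Mcoef eta a phi l m.
Proof.
move=> Lp; have Lw := Lsq_wig eta0 Lp Lp.
have N1 : -1 != 0 :> R by rewrite oppr_eq0 oner_eq0.
have half0 : 2^-1 != 0 :> R by rewrite invr_eq0 pnatr_eq0.
have Lwm : Lsq v2n (fun z => Wfun eta phi (- z)).
  under eq_fun do rewrite -scaleN1r -[X in Wfun _ _ X]addr0.
  exact: (Lsq_vol_affine 0 N1 Lw).
rewrite /Mcoef' wignerE// RtoCM -[RHS]mulrA; congr (_ * _).
set X := 4^-1 *: (l + m); set P := 2^-1 *: Jmap (m - l).
pose F z := expi (- sympl z (l - m) / eta) * RtoC (a z) * Wfun eta phi (z - 2^-1 *: (l + m)).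
have FE z : RtoC (a z) * wig eta (heis eta l phi) (heis eta m phi) z =
    expi (- sympl l m / (2 * eta)) * F z.
  by rewrite wig_heis// /F /wig -/(Wfun _ _ _); ring.
have Ll := Lsq_heis eta l Lp; have Lm := Lsq_heis eta m Lp.
rewrite McoefE// /weylB.
have iB := Cintegrable_weylB eta0 La Ll Lm.
have [iB' ->] := Cint_vol_affine X half0 iB.
rewrite mulrA -RtoCM ger0_norm ?invr_ge0// -exprMn divff ?pnatr_eq0// expr1n RtoC1 mul1r.
rewrite /fourierv; congr Cint; apply/funext => Y.
rewrite FE /F /ambig.
have -> : 2^-1 *: Y + X - 2^-1 *: (l + m) = - (X - 2^-1 *: Y).
  by apply/rowP => i; rewrite !mxE; field.
rewrite (addrC (2^-1 *: Y)) /Wfun -!/(wig eta phi phi _) wigJ//.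
rewrite -[in RHS]mulrA [in RHS]mulrA -expiD; congr (expi _ * _).
(* The part of the phase that comes from X is sigma(l, m) / (2 eta) and cancels the prefactor of
   [Mcoef]; the part linear in Y is the pairing with J (m - l) / 2. *)
rewrite /P dotvZl -/(sympl _ _) !symplE /X !halfmxE !dotvE.
by field.
Qed.

End CrossWignerMatrix.

(** * Density of the Gabor system *)

Section HilbertAlgebra.
Context (R : realType) d (T : measurableType d) (m : {measure set T -> \bar R}).
Local Notation C := R[i].
Implicit Types f g : T -> C.

Definition cip f g : C := Cint m (fun x => f x * conjc (g x)).

Lemma Cintegrable_cip f g : Lsq m f -> Lsq m g -> Cintegrable m (fun x => f x * conjc (g x)).
Proof. by move=> Lf Lg; apply: LsqM => //; exact: LsqJ. Qed.

Lemma cipZl c f g : Lsq m f -> Lsq m g -> cip (fun x => c * f x) g = c * cip f g.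
Proof.
move=> Lf Lg; rewrite /cip -CintZ; last exact: Cintegrable_cip.
by congr Cint; apply/funext => x; rewrite mulrA.
Qed.

Lemma cip_conj f g : Lsq m f -> Lsq m g -> conjc (cip f g) = cip g f.
Proof.
move=> Lf Lg; rewrite /cip -CintJ; last exact: Cintegrable_cip.
by congr Cint; apply/funext => x; rewrite conjM conjcK mulrC.
Qed.

Lemma cip_suml (I : Type) (r : seq I) (F : I -> T -> C) g :
  (forall i, Lsq m (F i)) -> Lsq m g ->
  cip (fun x => \sum_(i <- r) F i x) g = \sum_(i <- r) cip (F i) g.
Proof.
move=> LF Lg; rewrite /cip -Cint_sum; last by move=> i; exact: Cintegrable_cip.
by congr Cint; apply/funext => x; rewrite big_distrl.
Qed.

Lemma integrable_cabs2 f : Lsq m f -> m.-integrable setT (fun x => (cabs2 (f x))%:E).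
Proof.
move=> [mf nf]; apply/integrableP; split.
  exact/measurable_EFinP/measurable_cabs2.
by under eq_integral do rewrite gee0_abs ?lee_fin ?cabs2_ge0//.
Qed.

Lemma cip_self f : Lsq m f -> cip f f = RtoC (sqn m f).
Proof.
move=> Lf; apply: complex_eqP => /=.
  by congr fine; apply: eq_integral => x _; rewrite mulcJ.
by rewrite /Rintegral integral0_eq// => x _; rewrite mulcJ.
Qed.

Lemma sqnD (c : R) f g : Lsq m f -> Lsq m g ->
  sqn m (fun x => f x + RtoC c * g x) =
  sqn m f + 2 * c * complex.Re (cip f g) + c ^+ 2 * sqn m g.
Proof.
move=> Lf Lg.
have If := integrable_cabs2 Lf; have Ig := integrable_cabs2 Lg.
have [Ir _] := Cintegrable_cip Lf Lg.
have -> : sqn m (fun x => f x + RtoC c * g x) = Rintegral m setT (fun x =>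
    (cabs2 (f x) + 2 * c * complex.Re (f x * conjc (g x))) + c ^+ 2 * cabs2 (g x)).
  congr fine; apply: eq_integral => x _; congr EFin.
  by rewrite /cabs2 !ReImE /=; ring.
have I1 : m.-integrable setT (fun x => (cabs2 (f x) + 2 * c * complex.Re (f x * conjc (g x)))%:E).
  by under eq_fun do rewrite EFinD; apply: integrableD => //; exact: integrable_scaleE.
rewrite RintegralD//; last exact: integrable_scaleE.
rewrite RintegralD//; last exact: integrable_scaleE.
by rewrite !RintegralZl.
Qed.

(** The difference of the two sides is B^-1 |B z - w|^2 / 2. The weight will be the upper frame
    bound. *)
Lemma Re_mulJ_le (B : R) (z w : C) : 0 < B ->
  complex.Re (z * conjc w) <= (B * cabs2 z + B^-1 * cabs2 w) / 2.
Proof.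
move=> B0; rewrite !ReImE /cabs2.
set a := complex.Re z; set b := complex.Im z; set c := complex.Re w; set e := complex.Im w.
have h1 : 0 <= B^-1 * ((B * a - c) ^+ 2 + (B * b - e) ^+ 2).
  by rewrite mulr_ge0 ?invr_ge0 ?(ltW B0)// addr_ge0// sqr_ge0.
have h2 : B^-1 * ((B * a - c) ^+ 2 + (B * b - e) ^+ 2) =
    B * (a ^+ 2 + b ^+ 2) + B^-1 * (c ^+ 2 + e ^+ 2) - 2 * (a * c + b * e).
  by field; rewrite gt_eqF.
lra.
Qed.

(** The parallelogram law with the squared norm of f - g dropped. *)
Lemma sqn_triangle f g : Lsq m f -> Lsq m g ->
  sqn m (fun x => f x + g x) <= 2 * (sqn m f + sqn m g).
Proof.
move=> Lf Lg.
have := sqnD 1 Lf Lg; have := sqnD (-1) Lf Lg.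
have -> : (fun x => f x + RtoC 1 * g x) = fun x => f x + g x.
  by apply/funext => x; rewrite RtoC1 mul1r.
have := sqn_ge0 m (fun x => f x + RtoC (-1) * g x).
move=> h0 h1 h2; lra.
Qed.

End HilbertAlgebra.

Section Density.
Context (R : realType) (n : nat) (eta : R).
Local Notation C := R[i].
Local Notation V := 'rV[R]_n.
Local Notation Z := 'rV[R]_(n + n).
Local Notation vn := (vol R n).
Variables (phi : V -> C) (Lam : set Z) (A B : R).
Hypotheses (Lphi : Lsq vn phi) (A0 : 0 < A) (AB : A <= B).
Hypothesis frame : forall f : V -> C, L2 f ->
  (A%:E * norm2 f <= \esum_(l in Lam) (cabs2 (ip f (heis eta l phi)))%:E)%E /\
  (\esum_(l in Lam) (cabs2 (ip f (heis eta l phi)))%:E <= B%:E * norm2 f)%E.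

Let Lheis l : Lsq vn (heis eta l phi). Proof. exact: Lsq_heis. Qed.

Let B0 : 0 < B. Proof. exact: lt_le_trans AB. Qed.

Let ipE f l : Lsq vn f -> ip f (heis eta l phi) = cip vn f (heis eta l phi).
Proof. by move=> Lf; rewrite /ip rintC_Cint//; exact: Cintegrable_cip. Qed.

Let frameE f : Lsq vn f ->
  ((A * sqn vn f)%:E <= \esum_(l in Lam) (cabs2 (cip vn f (heis eta l phi)))%:E)%E /\
  (\esum_(l in Lam) (cabs2 (cip vn f (heis eta l phi)))%:E <= (B * sqn vn f)%:E)%E.
Proof.
move=> Lf; have /frame := (L2E f).2 Lf.
rewrite norm2E; last exact: Lf.1.
by rewrite -sqnE// -!EFinM; under eq_esum do rewrite ipE//.
Qed.

Let fsum_le f (F : set Z) : Lsq vn f -> finite_set F -> F `<=` Lam ->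
  \sum_(l <- fset_set F) cabs2 (cip vn f (heis eta l phi)) <= B * sqn vn f.
Proof.
move=> Lf fF FL; rewrite -lee_fin; apply: le_trans (frameE Lf).2.
apply: ereal_sup_ubound; exists F => //.
by rewrite fsbig_finite// sumEFin.
Qed.

(** Lists of coefficients and points may repeat a point, so that adding two combinations is
    concatenation; [gspan_collect] regroups them when a matrix is involved. *)
Definition gspan (s : seq (C * Z)) : V -> C :=
  fun x => \sum_(p <- s) p.1 * heis eta p.2 phi x.

Lemma Lsq_gspan s : Lsq vn (gspan s).
Proof. by apply: Lsq_sum => p; exact: LsqZ. Qed.

(* A truncated analysis followed by synthesis with the relaxation [B^-1]
   contracts the residual; only finite sums occur, so that the completeness of
   L^2 is not needed. *)
Lemma frame_step f : Lsq vn f ->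
  exists s : seq (C * Z), (forall p, p \in s -> Lam p.2) /\
    sqn vn (fun x => f x - gspan s x) <= (1 - A / (2 * B)) * sqn vn f.
Proof.
move=> Lf; have f0 := sqn_ge0 vn f.
pose zt l := cip vn f (heis eta l phi).
(* Halving A makes the lower frame inequality strict when f has positive norm, so some finite
   partial sum of the supremum already exceeds the halved bound. This is the origin of the 2 in A /
   (2 B). *)
have [F [fF FL] SF] : exists2 F : set Z, finite_set F /\ F `<=` Lam &
    A / 2 * sqn vn f <= \sum_(l <- fset_set F) cabs2 (zt l).
  have [->|fn0] := eqVneq (sqn vn f) 0.
    exists set0; first by split.
    by rewrite mulr0 sumr_ge0// => l _; exact: cabs2_ge0.
  have fp : 0 < sqn vn f by rewrite lt_neqAle eq_sym fn0.
  have : ((A / 2 * sqn vn f)%:E < \esum_(l in Lam) (cabs2 (zt l))%:E)%E.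
    apply: lt_le_trans (frameE Lf).1.
    by rewrite lte_fin ltr_pM2r//; move: A0; lra.
  move=> /ereal_sup_gt[_ [F [fF FL] <-]] lF; exists F => //.
  move: lF; rewrite fsbig_finite// sumEFin lte_fin => /ltW; exact.
set r := fset_set F in SF; set S := \sum_(l <- r) cabs2 (zt l) in SF.
pose h x := \sum_(l <- r) zt l * heis eta l phi x.
have Lh : Lsq vn h by apply: Lsq_sum => l; exact: LsqZ.
(* The synthesis bound by duality: pairing [h] with itself gives its own frame coefficients, whose
   sum the upper frame bound controls by B times the squared norm. Half of that norm appears on the
   right and is absorbed. *)
have hS : sqn vn h <= B * S.
  have hE : sqn vn h = \sum_(l <- r) complex.Re (zt l * conjc (cip vn h (heis eta l phi))).
    transitivity (complex.Re (cip vn h h)); first by rewrite cip_self.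
    rewrite {1}/h cip_suml//; last by move=> l; exact: LsqZ.
    rewrite (big_morph _ (@cReD R) (erefl _ : complex.Re (0 : C) = 0)).
    by apply: eq_bigr => l _; rewrite cipZl// cip_conj.
  have : sqn vn h <= (B * S + B^-1 * (B * sqn vn h)) / 2.
    rewrite {1}hE; apply: (@le_trans _ _ (\sum_(l <- r)
       (B * cabs2 (zt l) + B^-1 * cabs2 (cip vn h (heis eta l phi))) / 2)).
      by apply: ler_sum => l _; exact: Re_mulJ_le.
    rewrite -big_distrl /= ler_wpM2r ?invr_ge0// big_split /= -!big_distrr /=.
    by rewrite lerD2l ler_wpM2l ?invr_ge0 ?(ltW B0)// fsum_le.
  by rewrite mulKf ?gt_eqF//; lra.
have fhS : complex.Re (cip vn f h) = S.
  rewrite -cip_conj// cReJ {1}/h cip_suml//; last by move=> l; exact: LsqZ.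
  rewrite (big_morph _ (@cReD R) (erefl _ : complex.Re (0 : C) = 0)).
  apply: eq_bigr => l _; rewrite cipZl// -(cip_conj Lf (Lheis l)) -/(zt l).
  by rewrite mulcJ.
exists [seq (RtoC B^-1 * zt l, l) | l <- r]; split.
  move=> p /mapP[l lr ->] /=; apply: FL.
  by move: lr; rewrite /r in_fset_set// => /set_mem.
have -> : (fun x => f x - gspan [seq (RtoC B^-1 * zt l, l) | l <- r] x) =
    (fun x => f x + RtoC (- B^-1) * h x).
  apply/funext => x; rewrite /gspan big_map /= /h big_distrr /= -sumrN; congr (_ + _).
  apply: eq_bigr => l _; rewrite -!mulrA -mulNr; congr (_ * _).
  by apply: complex_eqP => //=; rewrite oppr0.
rewrite sqnD// fhS.
(* The cross term contributes - 2 S / B and, by [hS], the quadratic term at most S / B. *)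
have e1 : 2 * - B^-1 * S + (- B^-1) ^+ 2 * sqn vn h <= - (B^-1 * S).
  have : B^-1 ^+ 2 * sqn vn h <= B^-1 ^+ 2 * (B * S) by rewrite ler_wpM2l// sqr_ge0.
  have -> : B^-1 ^+ 2 * (B * S) = B^-1 * S by field; rewrite gt_eqF.
  rewrite sqrrN; lra.
have e2 : B^-1 * (A / 2 * sqn vn f) <= B^-1 * S by rewrite ler_wpM2l// invr_ge0 ltW.
have e3 : (1 - A / (2 * B)) * sqn vn f = sqn vn f - B^-1 * (A / 2 * sqn vn f).
  by field; rewrite gt_eqF.
rewrite e3; lra.
Qed.

Lemma frame_approx f k : Lsq vn f ->
  exists s : seq (C * Z), (forall p, p \in s -> Lam p.2) /\
    sqn vn (fun x => f x - gspan s x) <= (1 - A / (2 * B)) ^+ k * sqn vn f.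
Proof.
move=> Lf; elim: k => [|k [s [sL IH]]].
  exists [::]; split => //; rewrite expr0 mul1r le_eqVlt; apply/orP; left; apply/eqP.
  by congr sqn; apply/funext => x; rewrite /gspan big_nil subr0.
have Lr : Lsq vn (fun x => f x - gspan s x) by apply: LsqD => //; apply: LsqN; exact: Lsq_gspan.
have [s' [sL' le']] := frame_step Lr.
exists (s ++ s'); split; first by move=> p; rewrite mem_cat => /orP[/sL|/sL'].
have -> : (fun x => f x - gspan (s ++ s') x) = (fun x => f x - gspan s x - gspan s' x).
  by apply/funext => x; rewrite /gspan big_cat /= opprD addrA.
apply: (le_trans le'); rewrite exprS -mulrA ler_wpM2l//.
by rewrite subr_ge0 ler_pdivrMr ?mulr_gt0//; move: (ltW A0) AB; lra.
Qed.

End Density.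

(** Turns a list with repetitions into a family of coefficients on a prescribed index set, as
    [psd_on] tests it; points of [r] absent from the list get the empty sum. *)
Lemma gspan_collect (R : realType) n eta (phi : 'rV[R]_n -> R[i])
    (s : seq (R[i] * 'rV[R]_(n + n))) (r : seq 'rV[R]_(n + n)) :
  uniq r -> (forall p, p \in s -> p.2 \in r) ->
  gspan eta phi s =
  fun x => \sum_(l <- r) (\sum_(p <- s | p.2 == l) p.1) * heis eta l phi x.
Proof.
move=> ur sr; apply/funext => x; rewrite /gspan.
under [RHS]eq_bigr do rewrite big_distrl /=.
rewrite [RHS](exchange_big_dep xpredT)//=.
rewrite big_seq [RHS]big_seq; apply: eq_bigr => p ps.
rewrite (eq_bigl (fun l => l == p.2)); last by move=> l; rewrite eq_sym.
by rewrite -big_filter filter_pred1_uniq ?sr// big_seq1.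
Qed.

(** * Finiteness of lattice balls *)

Section Lattice.
Context (R : realType) (n : nat).
Local Notation Z := 'rV[R]_(n + n).

Lemma coord_le_dotv d (v : 'rV[R]_d) (i : 'I_d) : `|v ord0 i| <= Num.sqrt (dotv v v).
Proof.
rewrite -sqrtr_sqr ler_sqrt ?dotv_ge0// /dotv (bigD1 i)//= -expr2 lerDl.
by apply: sumr_ge0 => j _; rewrite -expr2 sqr_ge0.
Qed.

Lemma finite_int_box d (b : nat) : finite_set [set k : 'I_d -> int | forall i, (`|k i| <= b)%N].
Proof.
(* Integers from - b to b are shifted by b into the 2 b + 1 elements of an ordinal type. *)
apply: (@sub_finite_set _ _ ((fun (f : {ffun 'I_d -> 'I_(b + b).+1}) i =>
   (f i : nat)%:Z - b%:Z) @` setT)).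
  move=> k kb.
  have kl i : (`|(k i + b%:Z)%R| < (b + b).+1)%N by have := kb i; lia.
  exists [ffun i => Ordinal (kl i)] => //; apply/funext => i; rewrite ffunE /=.
  by have := kb i; lia.
by apply: finite_image; exact: finite_finset.
Qed.

Lemma finite_latball (Lam : set Z) N : is_lattice Lam -> finite_set (latball Lam N).
Proof.
move=> [M [uM ->]].
(* The integer coordinates of a lattice point l are those of l times M^-1, and each coordinate of l
   is at most N in absolute value; summing over all entries bounds every coordinate at once. *)
pose c : R := \sum_(i < n + n) \sum_(j < n + n) N%:R * `|invmx M j i|.
pose b := (Num.truncn c).+1.
apply: (@sub_finite_set _ _ ((fun k : 'I_(n + n) -> int => (\row_i (k i)%:~R) *m M) @`
    [set k | forall i, (`|k i| <= b)%N])); last first.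
  by apply: finite_image; exact: finite_int_box.
move=> l [[k _ lk] lN]; exists k => //= i.
have ki : (k i)%:~R = \sum_j l ord0 j * invmx M j i.
  by have := congr1 (fun v : Z => (v *m invmx M) ord0 i) lk; rewrite mulmxK// !mxE.
have kc : `|k i|%:R <= c.
  rewrite natr_absz intr_norm ki; apply: (le_trans (ler_norm_sum _ _ _)).
  rewrite /c [leRHS](bigD1 i)//= ler_wpDr//.
    by apply: sumr_ge0 => j _; apply: sumr_ge0 => ? _; rewrite mulr_ge0.
  apply: ler_sum => j _; rewrite normrM ler_wpM2r//.
  exact: le_trans (coord_le_dotv _ _) lN.
rewrite -(ler_nat R); apply: (le_trans kc); apply: ltW.
by rewrite /b truncnS_gt.
Qed.

Lemma latball_cover (Lam : set Z) (s : seq Z) : (forall l, l \in s -> Lam l) ->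
  exists N, forall l, l \in s -> latball Lam N l.
Proof.
elim: s => [|l s IH] sL; first by exists 0%N.
have [|N HN] := IH; first by move=> l' l's; apply: sL; rewrite inE l's orbT.
exists (maxn N (Num.truncn (Num.sqrt (dotv l l))).+1) => l'.
rewrite inE => /orP[/eqP ->|/HN[Ll lN]]; split => //.
- by apply: sL; rewrite inE eqxx.
- apply: (@le_trans _ _ (Num.truncn (Num.sqrt (dotv l l))).+1%:R).
    by apply: ltW; rewrite truncnS_gt.
  by rewrite ler_nat leq_maxr.
- by apply: (le_trans lN); rewrite ler_nat leq_maxl.
Qed.

End Lattice.

(** * From the matrices to the operator *)

Lemma complex_ge0E (R : realType) (z : R[i]) :
  (0 <= z) = (complex.Im z == 0) && (0 <= complex.Re z).
Proof. by rewrite lecE. Qed.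

(** A nonnegative summand can only bring a negative sum closer to 0, so [w] may be dropped; then (x
    + y + z)^2 <= 3 (x^2 + y^2 + z^2). Here [w] will be the form at an approximant, and the others
    the terms that contain the residual. *)
Lemma sqr_sum_neg_le (R : realDomainType) (w x y z M : R) :
  0 <= w -> w + x + (y + z) < 0 ->
  x ^+ 2 <= M -> y ^+ 2 <= M -> z ^+ 2 <= M -> (w + x + (y + z)) ^+ 2 <= 9 * M.
Proof.
move=> w0 neg xM yM zM.
apply: (@le_trans _ _ ((x + (y + z)) ^+ 2)).
  rewrite -subr_ge0 (_ : _ - _ = - (w * (w + 2 * (x + (y + z))))); last by ring.
  by rewrite oppr_ge0 mulr_ge0_le0//; lra.
have := sqr_ge0 (x - y); have := sqr_ge0 (x - z); have := sqr_ge0 (y - z).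
rewrite !expr2 in xM yM zM *; lra.
Qed.

Section Positivity.
Context (R : realType) (n : nat) (eta : R).
Hypothesis eta0 : eta != 0.
Local Notation C := R[i].
Local Notation V := 'rV[R]_n.
Local Notation Z := 'rV[R]_(n + n).
Local Notation vn := (vol R n).
Local Notation v2n := (vol R (n + n)).
Variable a : Z -> R.
Hypothesis La : Lsq v2n (fun z => RtoC (a z)).

Lemma psd_sumE (S : set Z) (Mx : Z -> Z -> C) (zeta : Z -> C) : finite_set S ->
  \sum_(l \in S) \sum_(m \in S) zeta l * conjc (zeta m) * Mx l m =
  \sum_(l <- fset_set S) \sum_(m <- fset_set S) zeta l * conjc (zeta m) * Mx l m.
Proof.
by move=> fS; rewrite fsbig_finite//; apply: eq_bigr => l _; rewrite fsbig_finite.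
Qed.

Lemma psd_on_scale (S : set Z) (c : R) (Mx Mx' : Z -> Z -> C) : finite_set S -> 0 < c ->
  (forall l m, Mx' l m = RtoC c * Mx l m) -> psd_on S Mx' <-> psd_on S Mx.
Proof.
move=> fS c0 ME.
have E zeta : \sum_(l \in S) \sum_(m \in S) zeta l * conjc (zeta m) * Mx' l m =
    RtoC c * \sum_(l \in S) \sum_(m \in S) zeta l * conjc (zeta m) * Mx l m.
  rewrite !psd_sumE// big_distrr; apply: eq_bigr => l _.
  by rewrite big_distrr; apply: eq_bigr => m _; rewrite ME mulrCA.
have c0' : 0 < RtoC c by rewrite ltcE /= eqxx.
split=> psd zeta; have h := psd zeta.
  by rewrite -(pmulr_rge0 _ c0') -E; exact: h.
by rewrite E (pmulr_rge0 _ c0'); exact: h.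
Qed.

Lemma weyl_nonneg_psd (phi : V -> C) (S : set Z) : Lsq vn phi -> finite_set S ->
  weyl_nonneg eta a -> psd_on S (Mcoef eta a phi).
Proof.
move=> Lp fS wn zeta; rewrite psd_sumE// -(weylB_sum eta0 La _ _ Lp).
have Lpsi : Lsq vn (fun x => \sum_(l <- fset_set S) zeta l * heis eta l phi x).
  by apply: Lsq_sum => l; apply: LsqZ; exact: Lsq_heis.
by rewrite -weyl_quadE//; apply: wn; exact/L2E.
Qed.

(** Expanding the form at f = g + r, the nonnegative value at [g] cannot help to make the sum
    negative, and the other three terms are small with [r]. The 36 is 9 from [sqr_sum_neg_le] times
    4 from the crude bound of the squared norm of [g] by 4 times that of [f]. The constant is fixed
    before [f] and [g], so it survives a change of approximant. *)
Lemma weylB_approx_le : exists K : R, 0 <= K /\ forall f g : V -> C,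
  Lsq vn f -> Lsq vn g -> 0 <= complex.Re (weylB eta a g g) ->
  forall q, 0 <= q <= 1 -> sqn vn (fun x => f x - g x) <= q * sqn vn f ->
  complex.Re (weylB eta a f f) < 0 ->
  complex.Re (weylB eta a f f) ^+ 2 <= q * (K * sqn vn f ^+ 2).
Proof.
have [K [K0 HK]] := weylB_le eta0 La.
exists (36 * K); split; first by rewrite mulr_ge0.
move=> f g Lf Lg Qg q /andP[q0 q1] rq Qf.
pose r x := f x - g x.
have Lr : Lsq vn r by apply: LsqD => //; exact: LsqN.
have fE : f = fun x => g x + r x by apply/funext => x; rewrite /r addrC subrK.
have QE : weylB eta a f f = weylB eta a g g + weylB eta a g r + (weylB eta a r g + weylB eta a r r).
  have Lgr := LsqD Lg Lr.
  by rewrite [in LHS]fE (weylBDl eta0 La Lg Lr Lgr) (weylBDr eta0 La Lg Lr Lg) (weylBDr eta0 La Lg Lr Lr).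
have f0 := sqn_ge0 vn f; have g0 := sqn_ge0 vn g; have r0 := sqn_ge0 vn r.
have rf : sqn vn r <= q * sqn vn f by [].
have rf1 : sqn vn r <= sqn vn f by apply: (le_trans rf); rewrite ler_piMl.
have gE : g = fun x => f x + (- r x).
  by apply/funext => x; rewrite /r subKr.
have sqnN : sqn vn (fun x => - r x) = sqn vn r.
  by congr fine; apply: eq_integral => x _; rewrite cabs2N.
have gf : sqn vn g <= 4 * sqn vn f.
  have := sqn_triangle Lf (LsqN Lr); rewrite -gE sqnN; lra.
have bnd u v : Lsq vn u -> Lsq vn v -> sqn vn u * sqn vn v <= 4 * (q * sqn vn f ^+ 2) ->
    complex.Re (weylB eta a u v) ^+ 2 <= 4 * (K * (q * sqn vn f ^+ 2)).
  move=> Lu Lv uv; apply: (@le_trans _ _ (cabs2 (weylB eta a u v))).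
    by rewrite /cabs2 lerDl sqr_ge0.
  apply: (le_trans (HK _ _ Lu Lv)); by rewrite [leRHS]mulrCA ler_wpM2l.
have grle : sqn vn g * sqn vn r <= 4 * (q * sqn vn f ^+ 2).
  rewrite (_ : 4 * _ = (4 * sqn vn f) * (q * sqn vn f)); last by ring.
  exact: ler_pM.
have rrle : sqn vn r * sqn vn r <= q * sqn vn f ^+ 2.
  rewrite (_ : q * _ = sqn vn f * (q * sqn vn f)); last by ring.
  exact: ler_pM.
have qf0 : 0 <= q * sqn vn f ^+ 2 by rewrite mulr_ge0// sqr_ge0.
have b1 := bnd g r Lg Lr grle.
have b2 : complex.Re (weylB eta a r g) ^+ 2 <= 4 * (K * (q * sqn vn f ^+ 2)).
  by apply: bnd => //; rewrite mulrC.
have b3 : complex.Re (weylB eta a r r) ^+ 2 <= 4 * (K * (q * sqn vn f ^+ 2)).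
  by apply: bnd => //; lra.
rewrite QE !cReD; move: Qf; rewrite QE !cReD.
rewrite (_ : q * _ = 9 * (4 * (K * (q * sqn vn f ^+ 2)))); last by ring.
by move=> Qf; exact: sqr_sum_neg_le.
Qed.

Lemma psd_weyl_nonneg (phi : V -> C) (Lam : set Z) : Lsq vn phi -> is_lattice Lam ->
  gabor_frame eta phi Lam ->
  (forall N, psd_on (latball Lam N) (Mcoef eta a phi)) -> weyl_nonneg eta a.
Proof.
move=> Lp lat [A [B [A0 [AB frame]]]] psd f /L2E Lf; rewrite weyl_quadE//.
have Qspan s : (forall p, p \in s -> Lam p.2) ->
    0 <= weylB eta a (gspan eta phi s) (gspan eta phi s).
  move=> sL; have [|N HN] := @latball_cover _ _ Lam [seq p.2 | p <- s].
    by move=> l /mapP[p ps ->]; exact: sL.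
  have fN := finite_latball N lat.
  (* All points of the list lie in one finite ball, where the coefficients, extended by 0, are a
     test vector for the matrix of that ball. *)
  rewrite (gspan_collect eta phi (r := fset_set (latball Lam N))) ?fset_uniq//; last first.
    move=> p ps; rewrite in_fset_set//; apply/mem_set/HN.
    by apply/mapP; exists p.
  rewrite weylB_sum//.
  have := psd N (fun l => \sum_(p <- s | p.2 == l) p.1).
  by rewrite psd_sumE.
have Im0 : complex.Im (weylB eta a f f) = 0.
  have := congr1 (fun z : C => complex.Im z) (weylBJ eta0 La Lf Lf).
  by rewrite cImJ; lra.
rewrite complex_ge0E Im0 eqxx andTb leNgt; apply/negP => Qf.
have [K [K0 HK]] := weylB_approx_le.
(* The lower bound follows from A <= B and the upper one from A > 0. *)
have q01 : 0 <= 1 - A / (2 * B) < 1.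
  have B0 : 0 < B by exact: lt_le_trans AB.
  rewrite subr_ge0 ler_pdivrMr ?mulr_gt0// ltrBlDr ltrDl divr_gt0 ?mulr_gt0// andbT.
  move: (ltW A0) AB; lra.
set q := 1 - A / (2 * B) in q01; case/andP: q01 => q0 q1.
have bound k : complex.Re (weylB eta a f f) ^+ 2 <= q ^+ k * (K * sqn vn f ^+ 2).
  have [s [sL le_s]] := frame_approx Lp A0 AB frame k Lf.
  have := Qspan s sL; rewrite complex_ge0E => /andP[_ Qs].
  apply: (HK _ _ Lf (Lsq_gspan _ Lp s) Qs) => //.
  by rewrite exprn_ge0//= exprn_ile1// ltW.
have lim0 : (fun k => q ^+ k * (K * sqn vn f ^+ 2)) @ \oo --> (0 : R).
  rewrite -(mul0r (K * sqn vn f ^+ 2)); apply: cvgM; last exact: cvg_cst.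
  by apply: cvg_expr; rewrite ger0_norm.
(* The left side does not depend on k, while the bound tends to 0 with q^k. *)
have : complex.Re (weylB eta a f f) ^+ 2 <= 0.
  rewrite -(cvg_lim _ lim0)//; apply: limr_ge; first by apply/cvg_ex; exists 0.
  by apply: nearW => k; exact: bound.
have : 0 < complex.Re (weylB eta a f f) ^+ 2 by rewrite exprn_even_gt0//= lt_eqF.
by move=> h1 h2; have := lt_le_trans h1 h2; rewrite ltxx.
Qed.

End Positivity.

Theorem mainTheorem2 (R : realType) (n : nat) (eta : R)
  (Lam : set 'rV[R]_(n + n)) (phi : 'rV[R]_n -> R[i]) (a : 'rV[R]_(n + n) -> R) :
  eta != 0 ->
  is_lattice Lam ->
  L2 phi ->
  gabor_frame eta phi Lam ->
  L2 (fun z => RtoC (a z)) ->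
  (weyl_nonneg eta a <-> forall N : nat, psd_on (latball Lam N) (Mcoef eta a phi)) /\
  (weyl_nonneg eta a <-> forall N : nat, psd_on (latball Lam N) (Mcoef' eta a phi)) /\
  (exists c : R, 0 < c /\
     forall l m, Lam l -> Lam m -> Mcoef' eta a phi l m = RtoC c * Mcoef eta a phi l m).
Proof.
move=> eta0 lat /L2E Lp frame /L2E La.
have fN N := finite_latball N lat.
have main : weyl_nonneg eta a <-> forall N, psd_on (latball Lam N) (Mcoef eta a phi).
  split; last exact: psd_weyl_nonneg.
  by move=> wn N; apply: weyl_nonneg_psd.
have c0 := Mcoef'_const_gt0 n eta0.
set c := (2 * pi * eta) ^- (n + n) * 2 ^+ (n + n) in c0.
have M'E l m : Mcoef' eta a phi l m = RtoC c * Mcoef eta a phi l m by exact: Mcoef'E.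
split => //; split; last by exists c; split => // l m _ _.
have M'P N := psd_on_scale (fN N) c0 M'E.
by apply: (iff_trans main); split=> psd N; [exact: (M'P N).2 | exact: (M'P N).1].
Qed.
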